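(* Let $L(x)=\sum_{n\ge 0}a_nx^n$, where $a_n$ is the number of $DD$-equivalence classes of paths of length $n$ in $\mathcal{E}$. Then $$L(x)=\frac{(4x^4-4x^2-4)\sqrt{-3x^4-2x^2+1}+8x^8+20x^6+8x^4-8x^3-4}{\left((-x^2-1)\sqrt{-3x^4-2x^2+1}+x^4+2x^2-1\right)\left(x^2+\sqrt{-3x^4-2x^2+1}+1\right)^2},$$ and $L(x)$ satisfies $$\begin{aligned}&x^{10}-x^9+4x^8-3x^7+5x^6-5x^5+2x^4-2x^3+x^2-x+1\\&+\left(-x^{10}+x^9-6x^8+5x^7-9x^6+6x^5-3x^4+3x^3+x-1\right)L(x)\\&+\left(x^{10}-x^9+4x^8-3x^7+5x^6-3x^5+2x^4-x^3\right)L(x)^2=0.\end{aligned}$$ The coefficients $a_2,a_3,\dots,a_{15}$ are $1,1,2,1,4,5,11,11,27,33,73,88,194,247$. Moreover, as $n\to\infty$, $$a_n\sim\frac{41\sqrt2}{2\sqrt\pi}\cdot\frac{\sqrt3^{\,n+1}}{n^{3/2}}\ \text{ for } n \text{ even},\qquad a_n\sim\frac{135\sqrt2}{4\sqrt\pi}\cdot\frac{\sqrt3^{\,n}}{n^{3/2}}\ \text{ for } n\text{ odd}.$$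
   Context: A Dyck path with catastrophes is a finite lattice path in the first quadrant ($y\ge 0$) starting at the origin, ending on the $x$-axis, with steps $U=(1,1)$, $D=(1,-1)$ and catastrophe steps $C_k=(1,-k)$, $k\ge 2$, where a catastrophe step must end on the $x$-axis (so $C_k$ can only be used from height $k$). $\mathcal{E}$ is the set of all Dyck paths with catastrophes (including the empty path). The length of a path is its number of steps. The pattern $DD$ occurs at position $i$ if the $i$-th and $(i+1)$-st steps are both $D$ (catastrophes $C_k$, $k\ge2$, are not $D$ steps). Two paths of $\mathcal{E}$ are $DD$-equivalent if they have the same length and the same set of positions of occurrences of $DD$. Generating functions are formal power series in $x$; square roots of power series have constant term $1$. The notation $a_n\sim b_n$ means $a_n/b_n\to 1$ (along $n$ of the indicated parity). *)

(* Defs.v *)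
From HB Require Import structures.
From mathcomp Require Import all_boot all_order all_algebra.
From mathcomp Require Import finmap.
From mathcomp Require Import all_classical all_reals all_analysis.
Set Implicit Arguments.
Unset Strict Implicit.
Unset Printing Implicit Defensive.
Import Order.TTheory GRing.Theory Num.Theory.
Import numFieldNormedType.Exports.
Local Open Scope classical_set_scope.
Local Open Scope ring_scope.

Record fps (R : Type) := Fps { fcoef : nat -> R }.
Add Printing Constructor fps.

Lemma fpsP (R : Type) (f g : fps R) : fcoef f =1 fcoef g -> f = g.
Proof. by case: f g => [f] [g] /= /funext ->. Qed.

HB.instance Definition _ (R : Type) := gen_eqMixin (fps R).
HB.instance Definition _ (R : Type) := gen_choiceMixin (fps R).

Section FpsZmodule.
Variable R : zmodType.
Implicit Types f g h : fps R.

Definition fps_zero : fps R := Fps (fun=> 0).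
Definition fps_opp f := Fps (fun n => - fcoef f n).
Definition fps_add f g := Fps (fun n => fcoef f n + fcoef g n).

Fact fps_addA : associative fps_add.
Proof. by move=> f g h; apply: fpsP => n /=; rewrite addrA. Qed.
Fact fps_addC : commutative fps_add.
Proof. by move=> f g; apply: fpsP => n /=; rewrite addrC. Qed.
Fact fps_add0 : left_id fps_zero fps_add.
Proof. by move=> f; apply: fpsP => n /=; rewrite add0r. Qed.
Fact fps_addN : left_inverse fps_zero fps_opp fps_add.
Proof. by move=> f; apply: fpsP => n /=; rewrite addNr. Qed.

HB.instance Definition _ :=
  GRing.isZmodule.Build (fps R) fps_addA fps_addC fps_add0 fps_addN.

End FpsZmodule.

Section FpsRing.
Variable R : comNzRingType.
Implicit Types f g h : fps R.

Definition fps_one : fps R := Fps (fun n => (n == 0%N)%:R).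
Definition fps_mul f g : fps R :=
  Fps (fun n => \sum_(i < n.+1) fcoef f i * fcoef g (n - i)).

Definition fps_trunc n f : {poly R} := \poly_(i < n.+1) fcoef f i.

Lemma fps_coef_trunc n k f : (k <= n)%N -> (fps_trunc n f)`_k = fcoef f k.
Proof. by move=> kn; rewrite coef_poly ltnS kn. Qed.

Lemma fps_mul_trunc n k f g : (k <= n)%N ->
  fcoef (fps_mul f g) k = (fps_trunc n f * fps_trunc n g)`_k.
Proof.
move=> kn; rewrite coefM /=; apply: eq_bigr => i _.
rewrite !fps_coef_trunc //; first exact: leq_trans (leq_subr _ _) kn.
by rewrite (leq_trans _ kn) // -ltnS.
Qed.

Fact fps_mulA : associative fps_mul.
Proof.
move=> f g h; apply: fpsP => n.
transitivity (fps_trunc n f * (fps_trunc n g * fps_trunc n h))`_n.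
  rewrite coefM; apply: eq_bigr => i _.
  rewrite fps_coef_trunc; last by rewrite -ltnS.
  congr (_ * _).
  by rewrite -fps_mul_trunc // leq_subr.
rewrite mulrA coefM; apply: eq_bigr => i _.
by rewrite fps_coef_trunc ?leq_subr // -fps_mul_trunc // -1?ltnS.
Qed.

Fact fps_mulC : commutative fps_mul.
Proof.
by move=> f g; apply: fpsP => n; rewrite !(@fps_mul_trunc n) // mulrC.
Qed.

Fact fps_mul1 : left_id fps_one fps_mul.
Proof.
move=> f; apply: fpsP => n /=; rewrite big_ord_recl /= mul1r subn0.
by rewrite big1 ?addr0 // => i _; rewrite /= mul0r.
Qed.

Fact fps_mulDl : left_distributive fps_mul +%R.
Proof.
move=> f g h; apply: fpsP => n /=; rewrite -big_split /=.
by apply: eq_bigr => i _; rewrite mulrDl.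
Qed.

Fact fps_one_neq0 : fps_one != 0.
Proof.
by apply/eqP => /(congr1 (fun f => fcoef f 0)) /eqP; rewrite /= oner_eq0.
Qed.

HB.instance Definition _ := GRing.Zmodule_isComNzRing.Build (fps R)
  fps_mulA fps_mulC fps_mul1 fps_mulDl fps_one_neq0.

Definition fpsX : fps R := Fps (fun n => (n == 1%N)%:R).

Lemma fcoef0 n : fcoef (0 : fps R) n = 0. Proof. by []. Qed.
Lemma fcoef1 n : fcoef (1 : fps R) n = (n == 0%N)%:R. Proof. by []. Qed.
Lemma fcoefD f g n : fcoef (f + g) n = fcoef f n + fcoef g n.
Proof. by []. Qed.
Lemma fcoefN f n : fcoef (- f) n = - fcoef f n. Proof. by []. Qed.
Lemma fcoefM f g n :
  fcoef (f * g) n = \sum_(i < n.+1) fcoef f i * fcoef g (n - i).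
Proof. by []. Qed.
Lemma fcoefM0 f g : fcoef (f * g) 0 = fcoef f 0 * fcoef g 0.
Proof. by rewrite fcoefM big_ord1. Qed.

End FpsRing.

(* Existence of sequences defined by course-of-values recursion: the value at
   [n] is computed by [F n] from the earlier values. *)
Lemma fps_rec (R : Type) (F : nat -> (nat -> R) -> R) :
  (forall n u v, (forall i, (i < n)%N -> u i = v i) -> F n u = F n v) ->
  forall c : R, exists u : nat -> R, forall n, u n = F n u.
Proof.
move=> Fext c.
pose step (n : nat) (u : nat -> R) := fun i => if i == n then F n u else u i.
pose U := fix U n := if n is m.+1 then step m (U m) else (fun=> c).
have Ustab n i : (i < n)%N -> U n i = U i.+1 i.
  elim: n => // n IH; rewrite ltnS leq_eqVlt => /predU1P[-> //|lt_in].
  by rewrite /= /step (ltn_eqF lt_in) IH //= /step eqxx.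
exists (fun n => U n.+1 n) => n; rewrite /= {1}/step eqxx.
by apply: Fext => i lt_in; rewrite Ustab.
Qed.

Section FpsUnitRing.
Variable F : fieldType.
Implicit Types f g : fps F.

Definition fps_unit : pred (fps F) := fun f => fcoef f 0 != 0.

Lemma fps_inv_exists f : fps_unit f -> exists g, g * f = 1.
Proof.
move=> f0.
pose G n (u : nat -> F) :=
  ((n == 0%N)%:R - \sum_(i < n) u i * fcoef f (n - i)) / fcoef f 0.
have [|u uE] := @fps_rec F G _ 0.
  move=> n u v uv; rewrite /G; congr ((_ - _) / _).
  by apply: eq_bigr => i _; rewrite uv.
exists (Fps u); apply: fpsP => n; rewrite fcoefM fcoef1 big_ord_recr /= subnn.
by rewrite [u n]uE /G divfK // addrC subrK.
Qed.

(* The inverse of a series with nonzero constant term; following the MathComp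
   convention, non-units are left unchanged. *)
Definition fps_inv f : fps F :=
  if fps_unit f then xget 0 [set g | g * f = 1] else f.

Fact fps_mulVf : {in fps_unit, left_inverse 1 fps_inv *%R}.
Proof.
move=> f fu; have fu' : fps_unit f by [].
rewrite /fps_inv fu'; have [g gf] := fps_inv_exists fu'.
exact: (@xgetI _ 0 [set g | g * f = 1] g).
Qed.

Fact fps_unitPl f g : g * f = 1 -> f \in fps_unit.
Proof.
move=> /(congr1 (fun h => fcoef h 0)); rewrite fcoefM0 fcoef1 eqxx => gf.
rewrite -[_ \in _]/(fcoef f 0 != 0); apply/eqP => f0.
by move/eqP: gf; rewrite f0 mulr0 eq_sym oner_eq0.
Qed.

Fact fps_inv_out : {in [predC fps_unit], fps_inv =1 id}.
Proof. by move=> f /negbTE fu; rewrite /fps_inv ifF. Qed.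

HB.instance Definition _ := GRing.ComNzRing_hasMulInverse.Build (fps F)
  fps_mulVf fps_unitPl fps_inv_out.

Lemma fps_unitE f : (f \is a GRing.unit) = (fcoef f 0 != 0).
Proof. by []. Qed.

End FpsUnitRing.

Section FpsSqrt.
Variable F : numFieldType.
Implicit Types f g : fps F.

Definition fps_sqrt f : fps F :=
  xget 0 [set g | g ^+ 2 = f /\ fcoef g 0 = 1].

Lemma fps_sqrt_exists f : fcoef f 0 = 1 ->
  exists g, g ^+ 2 = f /\ fcoef g 0 = 1.
Proof.
move=> f0.
pose G n (u : nat -> F) := if n is m.+1 then
  (fcoef f n - \sum_(i < m) u i.+1 * u (m - i)%N) / 2 else 1.
have [|u uE] := @fps_rec F G _ 0.
  move=> [//|m] u v uv; rewrite /G; congr ((_ - _) / _).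
  by apply: eq_bigr => i _; rewrite !uv // ltnS ?leq_subr ?ltn_ord.
have u0 : u 0 = 1 by rewrite uE.
exists (Fps u); split => //; apply: fpsP => -[|m].
  by rewrite expr2 fcoefM0 /= u0 mulr1 f0.
rewrite expr2 fcoefM big_ord_recl big_ord_recr /= subn0 subnn u0 mul1r mulr1.
under eq_bigr do rewrite /bump /= add1n subSS.
rewrite addrCA -mulr2n -mulr_natr [u m.+1]uE /G divfK ?pnatr_eq0 //.
by rewrite addrC subrK.
Qed.

Lemma fps_sqrtP f : fcoef f 0 = 1 ->
  fps_sqrt f ^+ 2 = f /\ fcoef (fps_sqrt f) 0 = 1.
Proof.
move=> /fps_sqrt_exists[g gP].
exact: (@xgetI _ 0 [set g | g ^+ 2 = f /\ fcoef g 0 = 1] g).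
Qed.

Lemma fps_sqrt_uniq f g : g ^+ 2 = f -> fcoef g 0 = 1 -> g = fps_sqrt f.
Proof.
move=> gf g0.
have f0 : fcoef f 0 = 1 by rewrite -gf expr2 fcoefM0 g0 mulr1.
have [sf s0] := fps_sqrtP f0.
have /eqP : (g - fps_sqrt f) * (g + fps_sqrt f) = 0.
  by rewrite -subr_sqr gf sf subrr.
have gsu : g + fps_sqrt f \is a GRing.unit.
  by rewrite fps_unitE fcoefD g0 s0 -[1 + 1]/(2%:R) pnatr_eq0.
by rewrite (can2_eq (mulrK gsu) (mulrVK gsu)) mul0r subr_eq0 => /eqP.
Qed.

End FpsSqrt.

(* [C k] is the step (1, -k); it is a catastrophe only when [2 <= k], which is
   required in [dyck_cat]. *)
Inductive step := U | D | C of nat.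

Definition dy (s : step) : int :=
  match s with U => 1 | D => -1 | C k => - (k%:Z) end.

(* Ordinate reached after the first [i] steps. *)
Definition height (w : seq step) (i : nat) : int := \sum_(s <- take i w) dy s.

Definition dyck_cat : set (seq step) :=
  [set w | [/\ forall i, 0 <= height w i,
               height w (size w) = 0
             & forall i k, onth w i = Some (C k) ->
                 (2 <= k)%N /\ height w i.+1 = 0]].

(* Positions are numbered from 0. *)
Definition DD_positions (w : seq step) : set nat :=
  [set i | onth w i = Some D /\ onth w i.+1 = Some D].

Definition DD_equiv (w v : seq step) : Prop :=
  size w = size v /\ DD_positions w = DD_positions v.

Definition dyck_cat_len (n : nat) : set (seq step) :=
  [set w | dyck_cat w /\ size w = n].

Definition DD_class (w : seq step) : set (seq step) :=
  [set v | dyck_cat v /\ DD_equiv w v].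

Definition DD_classes (n : nat) : set (set (seq step)) :=
  [set DD_class w | w in dyck_cat_len n].

(* [fset_set] of an infinite set would be empty; see [finite_DD_classes]. *)
Definition num_DD_classes (n : nat) : nat := #|` fset_set (DD_classes n)|.

Lemma height_le (w : seq step) i : height w i <= i%:Z.
Proof.
rewrite /height; elim: w i => [|s w IH] [|i]; rewrite ?big_nil //= big_cons.
by rewrite intS lerD //; case: s => //= k.
Qed.

Lemma heightS (w : seq step) i s : onth w i = Some s ->
  height w i.+1 = height w i + dy s.
Proof.
rewrite /height; elim: w i => [|t w IH] [|i] //=.
  by move=> [->]; rewrite take0 big_seq1 big_nil add0r.
by move=> /IH; rewrite !big_cons => ->; rewrite addrA.
Qed.

Lemma finite_dyck_cat_len n : finite_set (dyck_cat_len n).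
Proof.
pose A : set step := [set U; D] `|` (C @` `I_n.+1).
have finA : finite_set A.
  by rewrite !finite_setU; do !split => //; apply: finite_image; apply: finite_II.
have finS m : finite_set
    [set w : seq step | size w = m /\ forall i s, onth w i = Some s -> A s].
  elim: m => [|m IH].
    apply: (@sub_finite_set _ _ [set [::]]) => // w [].
    by move=> /size0nil ->.
  apply: sub_finite_set (finite_image2 cons finA IH) => -[[] //|s w [[sw] wA]].
  exists s; first exact: (wA 0%N).
  by exists w => //; split=> // i t; exact: (wA i.+1).
apply: sub_finite_set (finS n) => w [[_ _ wC] sw]; split=> // i [||k] wi.
- by left; left.
- by left; right.
right; exists k => //=; have [_ h0] := wC _ _ wi.
have lt_in : (i < n)%N by rewrite -sw ltnNge; apply/negP => /onth_default; rewrite wi.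
move: h0; rewrite (heightS wi) /= => /eqP; rewrite subr_eq0 => /eqP hi.
by have := height_le w i; rewrite hi lez_nat ltnS => /leq_trans; apply; exact: ltnW.
Qed.

Lemma finite_DD_classes n : finite_set (DD_classes n).
Proof. exact/finite_image/finite_dyck_cat_len. Qed.

Definition DD_gf : fps rat := Fps (fun n => (num_DD_classes n)%:R).

(* a_n ~ b_n as n tends to infinity along the n satisfying P. *)
Definition equiv_along (R : realType) (P : pred nat) (a b : nat -> R) : Prop :=
  (a n / b n) @[n --> within [set n | P n] \oo] --> (1 : R).

(* Main.v *)
(** Record, at every step, whether it closes an occurrence of [DD]. Replacing
    by [U] every step that lies in no run of two or more [D] gives the highest
    profile compatible with this record. If it has height [H] at the end of
    such a run, then exactly the heights [0, ..., H] other than [H - 1] are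
    reached by paths with the given record: an isolated [D] loses 2 and a
    catastrophe [C k] loses [k + 1 >= 3], so a total loss of 1 is impossible,
    while the fillings [U^g], [U^j C U^r] and [U D U^(g-2)] of the gaps realise
    all other losses. Hence a class is a word over [{U, D}] with nonnegative
    heights and no isolated [D], except that it may not end in [D] at height 1,
    nor in a single [U] at height 1 or 2.

    Let [E] be the series of such words at height 0, so that
    [E = 1 + x^2 E (x^2 E + E - 1)]. Last passages give [E / (1 - x E)] for all
    words, and [L = E / (1 - x E) - (x + x^2) E^2 + x^2 E].

    For the asymptotics put [t = x^2] and [T = 1 / (1 - t E^2)]: the even and
    odd parts of [L] are [E T - t E^2 + t E] and [x (E^2 T - E^2)]. After
    rescaling [t] to radius of convergence 1, sequences [f] with
    [f n * n^(3/2)] convergent are closed under Cauchy product, and under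
    [1 / (1 - g)] for nonnegative [g] of sum less than 1; here the sum is 3/4.
    The basic example is [sqrt (1 - u)], through Wallis' product. *)
Require Import Defs.
From mathcomp Require Import all_boot all_order all_algebra.
From mathcomp Require Import finmap zify ring lra.
From mathcomp Require Import all_classical all_reals all_analysis.
Import Order.TTheory GRing.Theory Num.Theory.
Import numFieldNormedType.Exports.
Local Open Scope classical_set_scope.
Local Open Scope ring_scope.
Set Implicit Arguments.
Unset Strict Implicit.
Unset Printing Implicit Defensive.

(** * Reversed paths and their DD words *)

Definition isD (s : step) : bool := if s is D then true else false.

(* Paths, and the words derived from them, are read backwards: the head of the
   list is the last step. *)
Fixpoint dd_word (v : seq step) : seq bool :=
  if v is s :: v' then (isD s && isD (head U v')) :: dd_word v' else [::].

(** The index is the ordinate reached; taking it in [nat] makes the condition of staying in the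
    quadrant automatic. *)
Inductive rdyck : seq step -> nat -> Prop :=
| rdyck_nil : rdyck [::] 0
| rdyck_U v h : rdyck v h -> rdyck (U :: v) h.+1
| rdyck_D v h : rdyck v h.+1 -> rdyck (D :: v) h
| rdyck_C v k : (2 <= k)%N -> rdyck v k -> rdyck (C k :: v) 0.

Lemma size_dd_word v : size (dd_word v) = size v.
Proof. by elim: v => //= s v ->. Qed.

Lemma nth_dd_word v j :
  nth false (dd_word v) j = isD (nth U v j) && isD (nth U v j.+1).
Proof. by elim: v j => [|s v IH] [|j] //=; case: v {IH}. Qed.

Lemma onth_D (w : seq step) i : onth w i = Some D <-> isD (nth U w i).
Proof. by elim: w i => [|s w IH] [|i] //=; case: s. Qed.

Lemma DD_positionsE (w : seq step) i :
  DD_positions w i <-> isD (nth U w i) && isD (nth U w i.+1).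
Proof.
split => [[/onth_D wi /onth_D wi1]|/andP[/onth_D wi /onth_D wi1]].
  by rewrite wi wi1.
by split.
Qed.

Lemma nth_dd_word_rev (w : seq step) j : (j.+1 < size w)%N ->
  nth false (dd_word (rev w)) j =
  isD (nth U w (size w - j.+2)) && isD (nth U w (size w - j.+2).+1).
Proof.
move=> jw; rewrite nth_dd_word !nth_rev ?(ltnW jw) // andbC; congr (_ && _).
by congr (isD (nth _ _ _)); lia.
Qed.

(** The word has one bit per step, so it remembers the length; bit [j] tells whether [DD] occurs at
    position [size w - j.+2]. *)
Lemma DD_equivE (w v : seq step) :
  DD_equiv w v <-> dd_word (rev w) = dd_word (rev v).
Proof.
split=> [[swv pwv]|ewv].
  apply: (@eq_from_nth _ false); first by rewrite !size_dd_word !size_rev.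
  move=> j; rewrite size_dd_word size_rev leq_eqVlt => /predU1P[jw|jw].
    (* The bit of the very first step looks at the default [U] behind it, hence is always false. *)
    by rewrite !nth_dd_word ![nth U _ j.+1]nth_default ?size_rev -?swv ?jw ?andbF.
  rewrite !nth_dd_word_rev -?swv //; apply/idP/idP => /DD_positionsE.
    by rewrite pwv => /DD_positionsE.
  by rewrite -pwv => /DD_positionsE.
have swv : size w = size v.
  by rewrite -[LHS]size_rev -[RHS]size_rev -!size_dd_word ewv.
split=> //; apply/seteqP.
suff H (x y : seq step) i : dd_word (rev x) = dd_word (rev y) ->
    size x = size y -> DD_positions x i -> DD_positions y i.
  by split=> i; apply: H.
move=> exy sxy /DD_positionsE xi; apply/DD_positionsE.
have ix : (i.+1 < size x)%N.
  by rewrite ltnNge; apply/negP => ix; move: xi;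
    rewrite [nth U x i.+1]nth_default ?andbF.
have /(congr1 (fun e => nth false e (size x - i.+2))) := exy.
rewrite !nth_dd_word_rev; try lia.
have -> : (size x - (size x - i.+2).+2 = i)%N by lia.
have -> : (size y - (size x - i.+2).+2 = i)%N by lia.
by rewrite xi => <-.
Qed.

Lemma height_rcons (w : seq step) s i : height (rcons w s) i =
  if (i <= size w)%N then height w i else height w (size w) + dy s.
Proof.
rewrite /height; case: leqP => iw; first by rewrite -cats1 takel_cat.
by rewrite !take_oversize ?size_rcons // big_rcons /= addrC.
Qed.

Lemma onth_rcons_step (w : seq step) s i : onth (rcons w s) i =
  if (i < size w)%N then onth w i else if i == size w then Some s else None.
Proof. by elim: w i => [|t w IH] [|i]; rewrite ?rcons_cons //;
  [by case: i|exact: IH]. Qed.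

Lemma dyck_catE (w : seq step) : dyck_cat w <-> rdyck (rev w) 0.
Proof.
split=> [[h0 hn hC]|].
  (* Induction over prefixes; heights are nonnegative, so the absolute value loses nothing. *)
  suff H i : (i <= size w)%N -> rdyck (rev (take i w)) `|height w i|%N.
    by have := H _ (leqnn _); rewrite take_size hn.
  elim: i => [|i IH] iw.
    by rewrite take0 /height take0 big_nil; exact: rdyck_nil.
  have := IH (ltnW iw); rewrite (take_nth U) // rev_rcons.
  have wi : onth w i = Some (nth U w i) by rewrite onthE (nth_map U).
  have := heightS wi; have := h0 i; have := h0 i.+1.
  case: (nth U w i) wi => [||k] wi hi1 hi /= hS p.
  - have -> : `|height w i.+1|%N = `|height w i|%N.+1 by lia.
    exact: rdyck_U.
  - apply: rdyck_D.
    by have <- : `|height w i|%N = `|height w i.+1|%N.+1 by lia.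
  - have [k2 hk] := hC _ _ wi; rewrite hk; apply: rdyck_C => //.
    by have <- : `|height w i|%N = k by lia.
suff H v h : rdyck v h -> [/\ forall i, 0 <= height (rev v) i,
               height (rev v) (size v) = h
             & forall i k, onth (rev v) i = Some (C k) ->
                 (2 <= k)%N /\ height (rev v) i.+1 = 0].
  by move=> /H; rewrite revK size_rev.
have H0 i : height [::] i = 0 by rewrite /height big_nil.
elim=> {v h} [|v h _ [h0 hn hC]|v h _ [h0 hn hC]|v k k2 _ [h0 hn hC]].
- by split=> [i||[]//]; rewrite /rev /= H0.
- rewrite rev_cons; split.
  + move=> i; rewrite height_rcons; case: ifP => // _; rewrite size_rev hn /=; lia.
  + by rewrite height_rcons size_rev /= ltnn hn /=; lia.
  + move=> i k; rewrite onth_rcons_step height_rcons; case: ltnP => [iv /hC[]//|_].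
    by case: eqP.
- rewrite rev_cons; split.
  + move=> i; rewrite height_rcons; case: ifP => // _; rewrite size_rev hn /=; lia.
  + by rewrite height_rcons size_rev /= ltnn hn /=; lia.
  + move=> i k; rewrite onth_rcons_step height_rcons; case: ltnP => [iv /hC[]//|_].
    by case: eqP.
- rewrite rev_cons; split.
  + move=> i; rewrite height_rcons; case: ifP => // _; rewrite size_rev hn /=; lia.
  + by rewrite height_rcons size_rev /= ltnn hn /=; lia.
  + move=> i j; rewrite onth_rcons_step height_rcons; case: ltnP => [iv /hC[]//|_].
    case: eqP => // _ [<-]; rewrite size_rev hn /=; split => //; lia.
Qed.

(** * The automaton of DD words *)

(* A state [(h, q)] consists of the highest possible ordinate [h] and of a mode:
   [q = 0] at the start and at the end of a run of [D], [q = 1] after exactly one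
   further step (which cannot be [D]), [q = 2] after more. In mode 2 the bit
   [true] reveals that the previous step, counted as [U], was [D]: hence the
   drop by 3. *)
Definition run_step (b : bool) (st : nat * nat) : option (nat * nat) :=
  let: (h, q) := st in
  if b then
    match q with
    | 0 => if h is h'.+1 then Some (h', 0%N) else None
    | 2 => if h is h'.+3 then Some (h', 0%N) else None
    | _ => None
    end
  else Some (h.+1, if q is 0 then 1 else 2)%N.

Fixpoint run (e : seq bool) : option (nat * nat) :=
  if e is b :: e' then obind (run_step b) (run e') else Some (0%N, 0%N).

Definition accepting (s : option (nat * nat)) : bool :=
  match s with
  | Some (h, 0) => h != 1%N
  | Some (h, 1) => (2 < h)%N
  | Some _ => true
  | None => false
  end.

Definition last_step_isD (v : seq step) := isD (head U v).

(* [h] is the ordinate of a path and [H] the highest one compatible with its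
   word; the loss [H - h] is never 1, and an isolated [D] costs 2. *)
Definition compatible (v : seq step) (h H q : nat) : Prop :=
  match q with
  | 0 => [/\ (h <= H)%N, h.+1 != H & last_step_isD v || nilp v]
  | 1 => [/\ (h <= H)%N, h.+1 != H, ~~ last_step_isD v & (0 < h)%N || (2 < H)%N]
  | 2 => if last_step_isD v then (h.+2 <= H)%N && (h.+3 != H)
         else (h <= H)%N && (h.+1 != H)
  | _ => False
  end.

(** A bit [false] raises the highest ordinate by 1, whatever the step is. A [D] that continues a run
    lowers both ordinates by 1; the second [D] of a run makes the highest one fall by 3, which
    cancels the loss of 2 charged to the first. *)
Lemma rdyck_run v h : rdyck v h ->
  exists H q, run (dd_word v) = Some (H, q) /\ compatible v h H q.
Proof.
elim=> {v h} [|v h p [H [q [E c]]]|v h p [H [q [E c]]]|v k k2 p [H [q [E c]]]].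
- by exists 0, 0.
- rewrite /= E; exists H.+1; case: q c {E} => [|[|[|//]]] /=.
  + by case=> *; exists 1; split=> //; split=> //=; lia.
  + by case=> *; exists 2; split=> //; rewrite /last_step_isD /=; lia.
  + by rewrite /last_step_isD; exists 2; split=> //=; case: ifP c; lia.
- rewrite /=; case: (boolP (isD (head U v))) => [vD|vU]; rewrite E.
  + case: q c {E} => [|[|[|//]]] /=.
    * case=> h1 h2 _; case: H h1 h2 => [|H] // h1 h2; exists H, 0.
      by split=> //; split=> //; lia.
    * by case; rewrite /last_step_isD vD.
    * rewrite /last_step_isD vD => /andP[h1 h2].
      case: H h1 h2 => [|[|[|H]]] // h1 h2; exists H, 0.
      by split=> //; split=> //; lia.
  + exists H.+1; case: q c {E} => [|[|[|//]]] /=.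
    (* Mode 0 without a final [D] is the empty path, after which no [D] is possible. *)
    * by rewrite /last_step_isD (negPf vU) /=; case=> _ _ /nilP v0; inversion p;
      subst.
    * by case=> *; exists 2; split=> //; rewrite /last_step_isD /=; lia.
    * by rewrite /last_step_isD (negPf vU) /=; exists 2; split=> //=; lia.
- rewrite /= E; exists H.+1; case: q c {E} => [|[|[|//]]] /=.
  + by case=> *; exists 1; split=> //; split=> //=; lia.
  + by case=> *; exists 2; split=> //; rewrite /last_step_isD /=; lia.
  + by rewrite /last_step_isD; exists 2; split=> //=; case: ifP c; lia.
Qed.

Lemma rdyck0_accepting v : rdyck v 0 -> accepting (run (dd_word v)).
Proof.
move=> /rdyck_run[H [q [-> c]]]; case: q c => [|[|[|//]]] //=.
  by case; lia.
by case; lia.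
Qed.

(** Splits off the last gap, so that paths can be built gap by gap. *)
Lemma run_gap e H q : run e = Some (H, q) -> exists g e0 H0,
  [/\ e = nseq g false ++ e0, run e0 = Some (H0, 0), H = (H0 + g)%N & q = minn g 2].
Proof.
elim: e H q => [|b e IH] H q; first by move=> [<- <-]; exists 0, [::], 0.
move=> E; have := E; rewrite /=; case: b E => /= E.
  suff q0 : q = 0.
    by rewrite q0 in E *; exists 0, (true :: e), H; split=> //; rewrite addn0.
  move: E; case: (run e) => [[h [|[|[|?]]]]|] //=; first by case: h => [|?] // [].
  by case: h => [|[|[|?]]] // [].
case R: (run e) => [[H1 q1]|//] [<- <-].
have [g [e0 [H0 [-> r0 -> ->]]]] := IH _ _ R.
by exists g.+1, e0, H0; split=> //; [rewrite addnS|case: g {R} => [|[|g]]].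
Qed.

Lemma rdyck_nseqU g v h : rdyck v h -> rdyck (nseq g U ++ v) (h + g).
Proof. by move=> p; elim: g => [|g IH] /=; rewrite ?addn0 // addnS;
  constructor. Qed.

Lemma dd_word_nseqU g v : dd_word (nseq g U ++ v) = nseq g false ++ dd_word v.
Proof. by elim: g => //= g ->. Qed.

(* The three fillings of a gap of length [g] starting at the maximal height
   [H]: [U^g], then [U^j C U^r] and, at heights 0 and 1, [U D U^(g-2)]. *)
Lemma fill_gap e H g r :
  (forall h, (h <= H)%N -> h.+1 != H ->
    exists v, [/\ rdyck v h, dd_word v = e & last_step_isD v || nilp v]) ->
  (0 < g)%N -> (1 < r <= H + g)%N -> r.+1 != (H + g)%N ->
  exists v, [/\ rdyck v r, dd_word v = nseq g false ++ e & ~~ last_step_isD v].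
Proof.
move=> R g0 /andP[r2 rH] rH1.
(* If [g <= r], the gap is climbed with [U] only, from ordinate [r - g]. Otherwise it starts at [H],
   and the catastrophe, placed [r] steps before the end, has size [H + (g - r.+1)]. *)
have [gr|rg] := leqP g r.
  have [||v [p <- _]] := R (r - g)%N; try lia.
  exists (nseq g U ++ v); split; last by case: g g0 {gr R p rH rH1}.
    by have := rdyck_nseqU g p; rewrite subnK.
  exact: dd_word_nseqU.
have [||v [p <- _]] := R H; try lia.
have [Hj|Hj] := leqP 2 (H + (g - r.+1)).
  exists (nseq r U ++ C (H + (g - r.+1)) :: nseq (g - r.+1) U ++ v); split.
  - by apply: (@rdyck_nseqU r _ 0); apply: rdyck_C => //; exact: rdyck_nseqU.
  - rewrite dd_word_nseqU /= dd_word_nseqU -[false :: _]/(nseq 1 false ++ _).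
    by rewrite !catA -!nseqD; congr (nseq _ _ ++ _); lia.
  - by case: r r2 {R rH rH1 rg Hj}.
(* The size of the catastrophe would be 1 here, since 0 is excluded by [r.+1 != H + g]; hence
   [r = H + g - 2], the loss of an isolated [D]. *)
exists (nseq (g - 2) U ++ D :: U :: v); split.
- have -> : r = (H + (g - 2))%N by lia.
  by apply: rdyck_nseqU; do 2 constructor.
- rewrite dd_word_nseqU /= -[[:: false, _ & _]]/(nseq 2 false ++ _).
  by rewrite !catA -!nseqD; congr (nseq _ _ ++ _); lia.
- by case E : (g - 2)%N => //; lia.
Qed.

Lemma run_reachable e H : run e = Some (H, 0) -> forall h,
  (h <= H)%N -> h.+1 != H ->
  exists v, [/\ rdyck v h, dd_word v = e & last_step_isD v || nilp v].
Proof.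
have [n] := ubnP (size e); elim: n e H => // n IH [|[] e] H.
- by move=> _ [<-] h; rewrite leqn0 => /eqP-> _; exists [::]; split=> //;
  constructor.
- rewrite ltnS => en E h hH hH1; case E1: (run e) => [[H1 q]|]; last first.
    by move: E; rewrite /= E1.
  have [g [e0 [H0 [ee0 r0 eH1 eq1]]]] := run_gap E1.
  case: q E1 eq1 => [|[|[|q]]] E1 eq1; last by lia.
  + have {}E : H1 = H.+1 by move: E; rewrite /= E1; case: (H1) => // ? [->].
    have [||v [p ev vD]] := IH e H1 en E1 h.+1; try lia.
    case/orP: vD => [vD|/nilP v0]; last by move: p; rewrite v0 => p; inversion p.
    exists (D :: v); split=> //; first by constructor.
    by rewrite /= ev -[isD (head U v)]/(last_step_isD v) vD.
  + by move: E; rewrite /= E1; case: (H1) => [|[|[|?]]].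
  + have {}E : H1 = H.+3 by move: E; rewrite /= E1;
    case: (H1) => [|[|[|?]]] // [->].
    (* The newest bit of the gap belongs to the first [D] of the run, so only [g.-1] steps are to be
       filled; they end at [h.+2], two [D] above the target. *)
    have [||||v [p ev vD]] := @fill_gap e0 H0 g.-1 h.+2 _; try lia.
      apply: IH r0; move: en; rewrite ee0 /= size_cat size_nseq; lia.
    exists (D :: D :: v); split=> //; first by do 2 constructor.
    rewrite /= -[isD (head U v)]/(last_step_isD v) (negPf vD) /= ev ee0.
    by case: g {E1 ee0 eH1 ev} eq1.
- by rewrite /= => _; case: (run e) => [[? [|?]]|].
Qed.

Lemma accepting_rdyck0 e : accepting (run e) ->
  exists2 v, rdyck v 0 & dd_word v = e.
Proof.
case E: (run e) => [[H q]|//].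
have [g [e0 [H0 [-> r0 -> eq]]]] := run_gap E.
have R := run_reachable r0.
have [g0|g0] := posnP g.
  rewrite g0 in eq *; rewrite {}eq addn0 /= => H1.
  by have [||v [p <- _]] := R 0; rewrite 1?eq_sym //; exists v.
(* Climb through the whole gap but one step, then fall to the axis, if the catastrophe is large
   enough. *)
have [H2 _|H2] := leqP 2 (H0 + g.-1).
  have [||v [p <- _]] := R H0; try lia.
  exists (C (H0 + g.-1) :: nseq g.-1 U ++ v).
    by apply: rdyck_C => //; exact: rdyck_nseqU.
  by rewrite /= dd_word_nseqU; case: g g0 {E eq H2}.
have [g1|g1] := eqVneq g 1.
  by rewrite g1 in eq H2 *; rewrite eq /=; lia.
(* What is left is a gap of length 2 at ordinate 0, filled by [U D]. *)
have -> : g = 2 by lia.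
have -> /= : H0 = 0 by lia.
have [||v [p <- _]] := R 0; try lia.
move=> _; exists (D :: U :: v) => //.
by apply: rdyck_D; apply: rdyck_U.
Qed.

(** * Classes counted as accepted bit words *)

Fixpoint bit_words (n : nat) : seq (seq bool) :=
  if n is n'.+1 then
    [seq true :: e | e <- bit_words n'] ++ [seq false :: e | e <- bit_words n']
  else [:: [::]].

Lemma mem_bit_words n e : (e \in bit_words n) = (size e == n).
Proof.
have mem_map_cons b c (e' : seq bool) s :
    (b :: e' \in [seq c :: x | x <- s]) = (b == c) && (e' \in s).
  apply/mapP/andP => [[x xs [-> ->]] //|[/eqP-> es]]; by exists e'.
elim: n e => [|n IH] [|b e] //=; rewrite mem_cat.
  by apply/negbTE/negP => /orP[] /mapP[? _].
by rewrite !mem_map_cons !IH; case: b; rewrite /= ?orbF eqSS.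
Qed.

Lemma bit_words_uniq n : uniq (bit_words n).
Proof.
have cons_inj b : injective (cons (b : bool)) by move=> ? ? [].
elim: n => //= n IH; rewrite cat_uniq !map_inj_uniq // IH andbT /=.
by apply/hasPn => e /mapP[x _ ->]; apply/negP => /mapP[? _].
Qed.

(** A class is the fibre [F] of its word, and the words with a nonempty fibre are exactly the
    accepted ones. Nonempty fibres of distinct words differ, so [F] is injective on them. *)
Lemma num_DD_classesE n :
  num_DD_classes n = count (accepting \o run) (bit_words n).
Proof.
pose F e : set (seq step) := [set v | dyck_cat v /\ dd_word (rev v) = e]%classic.
pose G := [seq e <- bit_words n | (accepting \o run) e].
have FG w : DD_class w = F (dd_word (rev w)).
  by apply/seteqP; split=> v [v1 v2]; split=> //; [apply/esym|]; apply/DD_equivE.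
have memG e : reflect (exists w, dyck_cat_len n w /\ dd_word (rev w) = e) (e \in G).
  rewrite mem_filter mem_bit_words; apply: (iffP andP).
    move=> [/accepting_rdyck0[v v0 ve] /eqP en]; exists (rev v).
    by rewrite revK; split=> //; split; [apply/dyck_catE;
      rewrite revK|rewrite size_rev -size_dd_word ve].
  move=> [w [[/dyck_catE w0 sw] <-]]; rewrite size_dd_word size_rev sw /=;
    split=> //.
  exact: rdyck0_accepting.
rewrite /num_DD_classes -size_filter -/G.
have -> : fset_set (DD_classes n) = [fset x in map F G]%fset.
  apply/fsetP => X; rewrite in_fset_set; last exact: finite_DD_classes.
  rewrite !inE; apply/idP/mapP => [/set_mem[w wn <-]|[e /memG[w [wn <-]] ->]].
    by rewrite FG; exists (dd_word (rev w)) => //; apply/memG; exists w.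
  by apply/mem_set; exists w => //; rewrite FG.
rewrite card_fseq undup_id ?size_map // map_inj_in_uniq ?filter_uniq
  ?bit_words_uniq //.
move=> e e' /memG[w [[wd _] <-]] _ Fe.
have : F (dd_word (rev w)) w by split.
by rewrite Fe => -[_ ->].
Qed.

Lemma num_DD_classes_2_15 : [seq num_DD_classes n | n <- iota 2 14]
        = [:: 1; 1; 2; 1; 4; 5; 11; 11; 27; 33; 73; 88; 194; 247]%N.
Proof. by rewrite (eq_map num_DD_classesE); vm_compute. Qed.

(** * Counting by the last-passage decomposition *)

Definition run_count (n : nat) (p : pred (option (nat * nat))) : nat :=
  count (p \o run) (bit_words n).

Lemma run_countS n p : run_count n.+1 p =
  (run_count n (p \o obind (run_step true))
   + run_count n (p \o obind (run_step false)))%N.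
Proof. by rewrite /run_count /= count_cat !count_map. Qed.

Lemma eq_run_count n p1 p2 : p1 =1 p2 -> run_count n p1 = run_count n p2.
Proof. by move=> p12; apply: eq_count => e /=. Qed.

Lemma run_countD n (p1 p2 : pred _) : (forall s, ~~ (p1 s && p2 s)) ->
  run_count n (predU p1 p2) = (run_count n p1 + run_count n p2)%N.
Proof.
move=> p12; rewrite /run_count -[RHS]count_predUI.
rewrite [X in (_ + X)%N](eq_count (a2 := pred0)) ?count_pred0 ?addn0 //.
by move=> e /=; apply/negbTE.
Qed.

Definition state_is (h q : nat) : pred (option (nat * nat)) :=
  fun st => if st is Some (h', q') then (h' == h) && (q' == q) else false.

Definition in_gap (h : nat) : pred (option (nat * nat)) :=
  fun st => state_is h 1 st || state_is h 2 st.

(** Discards the unreachable states, such as modes above 2, in the counts below. *)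
Lemma run_invariant e h q : run e = Some (h, q) ->
  (q < 3)%N && (h <= size e)%N && ((q == 2) ==> (1 < h)%N) && ((q == 1) ==> (0 <
    h)%N).
Proof.
elim: e h q => [|b e IH] h q /=; first by case=> <- <-.
case: (run e) IH => [[h' q']|//] /= /(_ _ _ erefl).
case: b => /=; last by move=> + [<- <-]; case: q' => [|[|[|?]]] //=; lia.
case: q' => [|[|[|?]]] //.
  by case: h' => [|h'] // + [<- <-] /=; lia.
by case: h' => [|[|[|h']]] // + [<- <-] /=; lia.
Qed.

Lemma run_count0 n (p : pred _) : p =1 pred0 -> run_count n p = 0%N.
Proof. by move=> p0; rewrite (eq_run_count _ p0) /run_count count_pred0. Qed.

Lemma run_count_freeS n h :
  run_count n.+1 (state_is h.+3 2) = run_count n (in_gap h.+2).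
Proof.
rewrite run_countS [X in (X + _)%N]run_count0.
  rewrite /run_count; apply: eq_in_count => e _ /=.
  case E: (run e) => [[h1 q]|] //=; have := run_invariant E.
  by case: q {E} => [|[|[|q]]] //= _;
    rewrite /in_gap /= ?(eqSS, andbT, andbF, orbF).
by move=> [[[|[|[|h1]]] [|[|[|q]]]]|] //=; rewrite ?andbF.
Qed.

Lemma run_count_gapS n h : run_count n.+1 (in_gap h.+1) =
  (run_count n (state_is h 0) + run_count n (in_gap h))%N.
Proof.
rewrite run_countS [X in (X + _)%N]run_count0 ?add0n; last first.
  by move=> [[[|[|[|h1]]] [|[|[|q]]]]|] //=; rewrite /in_gap /= ?andbF.
rewrite -run_countD; last first.
  by move=> [[h1 [|q]]|] //=; rewrite /in_gap /= ?(andbF, orbF).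
rewrite /run_count; apply: eq_in_count => e _ /=.
case E: (run e) => [[h1 q]|] //=; have := run_invariant E.
by case: q {E} => [|[|[|q]]] //= _; rewrite /in_gap /= ?(eqSS, andbT, andbF, orbF).
Qed.

Lemma run_count_gap0 n : run_count n (in_gap 0) = 0%N.
Proof.
rewrite /run_count; apply/eqP; rewrite -leqn0 leqNgt -has_count.
apply/hasPn => e _ /=; case E: (run e) => [[h q]|] //=.
have := run_invariant E.
by rewrite /in_gap /=; case: h {E} => [|h] //=; case: q => [|[|[|q]]].
Qed.

Lemma run_count_blockS n h : run_count n.+1 (state_is h 0) =
  (run_count n (state_is h.+1 0) + run_count n (state_is h.+3 2))%N.
Proof.
rewrite run_countS [X in (_ + X)%N]run_count0 ?addn0; last first.
  by move=> [[[|h1] [|q]]|] //=; rewrite ?andbF.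
rewrite -run_countD; last first.
  by move=> [[h1 [|q]]|] //=; rewrite ?andbF.
apply: eq_run_count => -[[h1 [|[|[|q]]]]|] //=;
  rewrite /in_gap /= ?(andbT, andbF, orbF) //.
  by case: h1 => [|h1]; rewrite /= ?(eqSS, andbT, andbF, orbF).
by case: h1 => [|[|[|h1]]] //=; rewrite ?(eqSS, andbT, andbF, orbF).
Qed.

Lemma run_count_gap1S n h : run_count n.+1 (state_is h.+1 1) =
  run_count n (state_is h 0).
Proof.
rewrite run_countS [X in (X + _)%N]run_count0 ?add0n; last first.
  by move=> [[[|[|[|h1]]] [|[|[|q]]]]|] //=; rewrite /in_gap /= ?andbF.
by apply: eq_run_count => -[[h1 [|[|[|q]]]]|] //=; rewrite ?andbF.
Qed.

Lemma run_count_isSome n : run_count n isSome =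
  (\sum_(h < n.+1) (run_count n (state_is h 0) + run_count n (in_gap h)))%N.
Proof.
have E h : (run_count n (state_is h 0) + run_count n (in_gap h))%N =
    (\sum_(e <- bit_words n) (if run e is Some (h',
      _) then (h' == h) : nat else 0))%N.
  rewrite -run_countD; last by move=> [[h1 [|q]]|] //=;
    rewrite /in_gap /= ?(andbF, orbF).
  rewrite /run_count -sum1_count big_mkcond; apply: eq_bigr => e _ /=.
  case E: (run e) => [[h1 q]|] //=; have := run_invariant E.
  by case: q {E} => [|[|[|q]]] //= _; rewrite /in_gap /= ?(andbT, andbF, orbF) ;
    case: eqP.
under eq_bigr do rewrite E.
rewrite exchange_big /run_count -sum1_count big_mkcond /=.
apply: eq_big_seq => e; rewrite mem_bit_words => /eqP en.
case E1: (run e) => [[h q]|] /=; last by rewrite big1.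
have hn : (h < n.+1)%N by have /andP[/andP[/andP[_ +] _] _] := run_invariant E1;
  rewrite en.
rewrite (bigD1 (Ordinal hn)) //= eqxx big1 // => i /eqP ni.
by case: eqP => // hi; case: ni; apply: val_inj.
Qed.

(** Among reachable states [accepting] fails only at [(1, 0)], [(1, 1)] and [(2, 1)]. *)
Lemma num_DD_classes_split n :
  (num_DD_classes n + run_count n (state_is 1 0) + run_count n (state_is 1 1)
   + run_count n (state_is 2 1) = run_count n isSome)%N.
Proof.
rewrite num_DD_classesE -/(run_count n accepting).
rewrite -!run_countD; try by move=> [[[|[|[|h]]] [|[|[|q]]]]|].
rewrite /run_count; apply: eq_in_count => e _ /=.
case E: (run e) => [[h q]|] //=; have := run_invariant E.
by case: q {E} => [|[|[|q]]] //=; case: h => [|[|[|h]]].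
Qed.

Section LastPassage.
Variable F : comNzRingType.
Implicit Types f : fps F.
Let x : fps F := fpsX F.

Lemma fcoefXM f n : fcoef (x * f) n.+1 = fcoef f n.
Proof.
rewrite fcoefM !big_ord_recl /= mul0r add0r subSS subn0 mul1r big1 ?addr0 //.
by move=> i _ /=; rewrite mul0r.
Qed.

Lemma fcoefXM0 f : fcoef (x * f) 0 = 0.
Proof. by rewrite fcoefM0 mul0r. Qed.

Lemma fcoefXnM f m n : (n < m)%N -> fcoef (x ^+ m * f) n = 0.
Proof.
elim: m n => // m IH [|n] nm; rewrite exprS -mulrA ?fcoefXM0 ?fcoefXM //.
exact: IH.
Qed.

Variables E P : fps F.
Hypothesis E_eq : E = 1 + x ^+ 2 * E * (x ^+ 2 * E + E - 1).
Hypothesis P_eq : P = E + x * E * P.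

(** Last passages cut a word ending at height [h] into [h + 1] excursions separated by [h] steps
    [U]. The last excursion is nonempty when the word ends in a run of [D] and empty when it ends in
    a gap, whence the factors [E - 1] and 1. These forms are verified through the recurrences of the
    automaton. *)
Let blockgf (h : nat) := (if h is 0 then E else x ^+ h * E ^+ h * (E - 1)) : fps F.
Let gapgf (h : nat) := (if h is 0 then 0 else x ^+ h * E ^+ h) : fps F.

Lemma blockgfE h : blockgf h = (h == 0%N)%:R + x * (blockgf h.+1 + x * gapgf h.+2).
Proof.
have -> : x * (blockgf h.+1 + x * gapgf h.+2) =
    x ^+ h * E ^+ h * (x ^+ 2 * E * (x ^+ 2 * E + E - 1)) by rewrite /= !exprS;
      ring.
have -> : x ^+ 2 * E * (x ^+ 2 * E + E - 1) = E - 1 by rewrite [in RHS]E_eq; ring.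
by case: h => [|h] /=; ring.
Qed.

Lemma gapgfE h : gapgf h.+1 = x * (blockgf h + gapgf h).
Proof. by case: h => [|h] /=; rewrite ?exprS; ring. Qed.

(** Induction on the length, for all heights at once because removing a bit may raise the height.
    The third part counts the states from which a run can start. *)
Lemma run_count_gf n : forall h,
  [/\ (run_count n (state_is h 0))%:R = fcoef (blockgf h) n,
      (run_count n (in_gap h))%:R = fcoef (gapgf h) n
    & (run_count n (state_is h.+3 2))%:R = fcoef (x * gapgf h.+2) n].
Proof.
elim: n => [|n IH] h.
  split; first by rewrite blockgfE fcoefD fcoefXM0 addr0; case: h.
  - by case: h => [|h] //; rewrite gapgfE fcoefXM0.
  - by rewrite fcoefXM0.
split.
- have [e1 _ _] := IH h.+1; have [_ _ e] := IH h.
  rewrite run_count_blockS natrD e e1.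
  by rewrite [in RHS]blockgfE fcoefD fcoefXM fcoefD; case: (h) => [|?];
    rewrite add0r.
- case: h => [|h]; first by rewrite run_count_gap0.
  by have [e1 e2 _] := IH h; rewrite run_count_gapS natrD e1 e2 [in RHS]gapgfE
    fcoefXM.
- by have [_ e _] := IH h.+2; rewrite run_count_freeS fcoefXM.
Qed.

Lemma last_passage_gf n :
  fcoef P n = \sum_(h < n.+1) fcoef (x ^+ h * E ^+ h.+1) n.
Proof.
(* Unroll [P_eq]; with [m = n.+1] the remainder is divisible by [x ^+ n.+1] and does not reach
   coefficient [n]. *)
have PE m : P = \sum_(h < m) x ^+ h * E ^+ h.+1 + x ^+ m * (E ^+ m * P).
  elim: m => [|m IH]; first by rewrite big_ord0 add0r !expr0 !mul1r.
  by rewrite big_ord_recr /= {1}IH {1}P_eq !exprS; ring.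
have sumE m : fcoef (\sum_(h < m) x ^+ h * E ^+ h.+1) n =
    \sum_(h < m) fcoef (x ^+ h * E ^+ h.+1) n.
  by elim: m => [|m IH]; rewrite ?big_ord0 // !big_ord_recr fcoefD IH.
by rewrite {1}(PE n.+1) fcoefD fcoefXnM // addr0 sumE.
Qed.

Lemma num_DD_classes_gf n :
  (num_DD_classes n)%:R = fcoef (P - (x + x ^+ 2) * E ^+ 2 + x ^+ 2 * E) n.
Proof.
(* The subtracted terms are the rejected states: [blockgf 1] for [(1, 0)], and one more bit after a
   state [(0, 0)] or [(1, 0)] for the other two. *)
have -> : P - (x + x ^+ 2) * E ^+ 2 + x ^+ 2 * E =
    P - blockgf 1 - x * (blockgf 0 + blockgf 1) by rewrite /=; ring.
rewrite 2!fcoefD 2!fcoefN last_passage_gf.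
have -> : \sum_(h < n.+1) fcoef (x ^+ h * E ^+ h.+1) n = (run_count n isSome)%:R.
  rewrite run_count_isSome natr_sum; apply: eq_bigr => h _; rewrite natrD.
  have [-> -> _] := run_count_gf n h; rewrite -fcoefD; congr (fcoef _ n).
  by case: (val h) => [|k] /=; rewrite ?exprS; ring.
have [<- _ _] := run_count_gf n 1.
have -> : fcoef (x * (blockgf 0 + blockgf 1)) n =
    (run_count n (state_is 1 1) + run_count n (state_is 2 1))%:R.
  case: n => [|n]; first by rewrite fcoefXM0.
  rewrite !run_count_gap1S natrD fcoefXM fcoefD.
  by have [-> _ _] := run_count_gf n 0; have [-> _ _] := run_count_gf n 1.
by rewrite -num_DD_classes_split !natrD; ring.
Qed.
End LastPassage.

(** * The closed form and the quadratic equation *)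

(** The equation is [t (1 + t) E^2 - (1 + t) E + 1 = 0], of discriminant [(1 + t) (1 - 3 t) = s^2].
    The rationalised root avoids dividing by [t], which is not a unit in the applications. *)
Lemma kernel_root (A : comUnitRingType) (t s : A) :
  s ^+ 2 = - 3 * t ^+ 2 - 2 * t + 1 -> 1 + t + s \is a GRing.unit ->
  let E := 2 / (1 + t + s) in E = 1 + t * E * (t * E + E - 1).
Proof.
move=> s2 Ku E; apply: (mulIr Ku); apply: (mulIr Ku).
have EK : E * (1 + t + s) = 2 by rewrite divrK.
have -> : (1 + t * E * (t * E + E - 1)) * (1 + t + s) * (1 + t + s) =
  (1 + t + s) ^+ 2 + t * (E * (1 + t + s)) * (t * (E * (1 + t + s)) + (E * (1 +
    t + s)) - (1 + t + s)).
  by ring.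
by rewrite EK; ring: s2.
Qed.

Section ClosedForm.
Let x : fps rat := fpsX rat.
Let s : fps rat := fps_sqrt (- 3 * x ^+ 4 - 2 * x ^+ 2 + 1).
Let E : fps rat := 2 / (1 + x ^+ 2 + s).
Let P : fps rat := E / (1 - x * E).

Lemma fcoefn0 n : fcoef (n%:R : fps rat) 0 = n%:R.
Proof. by elim: n => // n IH; rewrite -addn1 !natrD fcoefD IH. Qed.

Lemma fcoefX0 (f : fps rat) n : fcoef (f ^+ n) 0 = fcoef f 0 ^+ n.
Proof. by elim: n => // n IH; rewrite !exprS fcoefM0 IH. Qed.

Let fcoefs0 := (fcoefD, fcoefN, fcoefM0, fcoefX0, fcoefn0, fcoef1).

Let x0 : fcoef x 0 = 0. Proof. by []. Qed.

Let s2_s0 : s ^+ 2 = - 3 * x ^+ 4 - 2 * x ^+ 2 + 1 /\ fcoef s 0 = 1.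
Proof.
apply: fps_sqrtP; rewrite !fcoefs0 x0 /=. ring.
Qed.

Let s2 := s2_s0.1.
Let s0 := s2_s0.2.

Let K_unit : 1 + x ^+ 2 + s \is a GRing.unit.
Proof. by rewrite fps_unitE !fcoefs0 x0 s0. Qed.

Let EK : E * (1 + x ^+ 2 + s) = 2. Proof. by rewrite divrK. Qed.

Let xE_unit : 1 - x * E \is a GRing.unit.
Proof. by rewrite fps_unitE !fcoefs0 x0 mul0r. Qed.

Let E_eq : E = 1 + x ^+ 2 * E * (x ^+ 2 * E + E - 1).
Proof. by apply: kernel_root => //; rewrite s2; ring. Qed.

Let P_eq : P = E + x * E * P.
Proof.
have P1 : P * (1 - x * E) = E by rewrite divrK.
by rewrite -[X in _ = X + _]P1; ring.
Qed.

Let PK : P * (1 + x ^+ 2 + s - 2 * x) = 2.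
Proof.
have -> : 1 + x ^+ 2 + s - 2 * x = (1 + x ^+ 2 + s) * (1 - x * E).
  by rewrite mulrBr mulr1 mulrCA [X in x * X]mulrC EK [x * 2]mulrC.
by rewrite mulrCA divrK // mulrC EK.
Qed.

Lemma DD_gfE : DD_gf = P - (x + x ^+ 2) * E ^+ 2 + x ^+ 2 * E.
Proof. by apply: fpsP => n; rewrite -num_DD_classes_gf. Qed.

Lemma DD_gf_closed_form :
  DD_gf = ((4 * x ^+ 4 - 4 * x ^+ 2 - 4) * s
             + 8 * x ^+ 8 + 20 * x ^+ 6 + 8 * x ^+ 4 - 8 * x ^+ 3 - 4)
          / (((- x ^+ 2 - 1) * s + x ^+ 4 + 2 * x ^+ 2 - 1)
             * (x ^+ 2 + s + 1) ^+ 2).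
Proof.
set den1 := _ - 1.
(* With [K = 1 + x ^+ 2 + s] one has [-2 * den1 = (K - 2 * x) * (K + 2 * x)], and
   [P = 2 / (K - 2 * x)]. *)
have den1P : P * den1 = - (1 + x ^+ 2 + s + 2 * x).
  have u2 : (2 : fps rat) \is a GRing.unit by rewrite fps_unitE fcoefn0.
  apply: (mulIr u2).
  have -> : P * den1 * 2 = - (P * (1 + x ^+ 2 + s - 2 * x)) * (1 + x ^+ 2 + s +
    2 * x).
    by rewrite /den1; ring: s2.
  by rewrite PK; ring.
have denu : den1 * (x ^+ 2 + s + 1) ^+ 2 \is a GRing.unit.
  by rewrite fps_unitE /den1 !fcoefs0 x0 s0.
apply: (mulIr denu); rewrite divrK // DD_gfE.
have -> : (P - (x + x ^+ 2) * E ^+ 2 + x ^+ 2 * E) * (den1 * (x ^+ 2 + s + 1) ^+ 2)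
  = (P * den1) * (1 + x ^+ 2 + s) ^+ 2 - (x + x ^+ 2) * (E * (1 + x ^+ 2 +
    s)) ^+ 2 * den1
    + x ^+ 2 * (E * (1 + x ^+ 2 + s)) * (1 + x ^+ 2 + s) * den1 by ring.
by rewrite den1P EK /den1; ring: s2.
Qed.

Lemma DD_gf_quadratic : let L := DD_gf in
      (x ^+ 10 - x ^+ 9 + 4 * x ^+ 8 - 3 * x ^+ 7 + 5 * x ^+ 6 - 5 * x ^+ 5
         + 2 * x ^+ 4 - 2 * x ^+ 3 + x ^+ 2 - x + 1)
      + (- x ^+ 10 + x ^+ 9 - 6 * x ^+ 8 + 5 * x ^+ 7 - 9 * x ^+ 6 + 6 * x ^+ 5
         - 3 * x ^+ 4 + 3 * x ^+ 3 + x - 1) * L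
      + (x ^+ 10 - x ^+ 9 + 4 * x ^+ 8 - 3 * x ^+ 7 + 5 * x ^+ 6 - 3 * x ^+ 5
         + 2 * x ^+ 4 - x ^+ 3) * L ^+ 2 = 0.
Proof.
move=> L; set K := 1 + x ^+ 2 + s.
have Du : K ^+ 2 * (K - 2 * x) \is a GRing.unit.
  by rewrite fps_unitE /K !fcoefs0 x0 s0.
have LD : L * (K ^+ 2 * (K - 2 * x)) =
    2 * K ^+ 2 - 4 * (x + x ^+ 2) * (K - 2 * x) + 2 * x ^+ 2 * K * (K - 2 * x).
  have -> : L * (K ^+ 2 * (K - 2 * x)) = P * (K - 2 * x) * K ^+ 2
     - (x + x ^+ 2) * (E * K) ^+ 2 * (K - 2 * x) +
       x ^+ 2 * (E * K) * K * (K - 2 * x).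
    by rewrite /L DD_gfE; ring.
  by rewrite PK EK; ring.
(* After multiplication by the square of the denominator of [L], only a polynomial identity in [x]
   and [s] modulo [s2] remains. *)
apply: (mulIr Du); apply: (mulIr Du); rewrite !mul0r.
have clear_denominators c1 c2 c3 l D : (c1 + c2 * l + c3 * l ^+ 2) * D * D =
    c1 * D ^+ 2 + c2 * (l * D) * D + c3 * (l * D) ^+ 2 :> fps rat by ring.
by rewrite clear_denominators LD /K; ring: s2.
Qed.
End ClosedForm.

(** * Coefficient asymptotics of order n^(-3/2) *)

Lemma cvgn_distP (R : realType) (u : nat -> R) (l : R) :
  (forall e, 0 < e -> exists N, forall n, (N <= n)%N -> `|l - u n| <= e) <->
  u @ \oo --> l.
Proof.
split=> [H|/cvgrPdist_le H e /H[N _ HN]]; last by exists N => n; exact: HN.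
by apply/cvgrPdist_le => e /H[N HN]; exists N => // n; exact: HN.
Qed.

Lemma cvgn_bounded (R : realType) (u : nat -> R) (l : R) :
  u @ \oo --> l -> exists2 K, 0 <= K & forall n, `|u n| <= K.
Proof.
move=> ul; have /cvg_has_ub[K uK] : cvgn u by apply/cvg_ex; exists l.
have Kn n : `|u n| <= K by apply: uK; exists n.
by exists K => //; apply: le_trans (Kn 0%N).
Qed.

Lemma cvgn_sum (R : realType) (a : nat -> nat -> R) (l : nat -> R) N :
  (forall k, a ^~ k @ \oo --> l k) ->
  (fun n => \sum_(0 <= k < N) a n k) @ \oo --> \sum_(0 <= k < N) l k.
Proof.
move=> al; elim: N => [|N IH].
  by under eq_fun do rewrite big_nil; rewrite big_nil; exact: cvg_cst.
under eq_fun do rewrite big_nat_recr //=.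
by rewrite big_nat_recr //=; exact: cvgD.
Qed.

(** Dominated convergence for series, in the diagonal form where the number of terms grows with
    [n]. *)
Lemma tannery (R : realType) (a : nat -> nat -> R) (M l : nat -> R) (B S : R) :
  (forall n k, `|a n k| <= M k) ->
  (forall n, \sum_(0 <= k < n) M k <= B) ->
  (forall k, a ^~ k @ \oo --> l k) ->
  series l @ \oo --> S ->
  (fun n => \sum_(0 <= k < n) a n k) @ \oo --> S.
Proof.
move=> aM MB al lS.
have M0 k : 0 <= M k by apply: le_trans (aM 0%N k).
have lM k : `|l k| <= M k.
  by apply: (cvgr_to_le (cvg_norm (al k))); apply: nearW => n; exact: aM.
have ndM : nondecreasing_seq (series M).
  by apply: nondecreasing_series => n _ _.
have Mcvg : cvgn (series M).
  by apply: nondecreasing_is_cvgn => //; exists B => _ [n _ <-]; exact: MB.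
have tailM e : 0 < e -> exists N, forall n, (N <= n)%N ->
    \sum_(N <= k < n) M k <= e.
  move=> e0; have /cvgn_distP/(_ e e0)[N HN] : series M @ \oo --> limn (series M)
    by [].
  exists N => n Nn; rewrite -sub_series_geq //.
  have := HN _ (leqnn N); rewrite ler_norml => /andP[_].
  have := nondecreasing_cvgn_le ndM Mcvg n.
  by rewrite /= => h1 h2; apply: le_trans h2; rewrite lerD2r.
(* Four errors of [e / 4]: the two tails beyond [N], the heads up to [N], and the partial sum of [l]
   against [S]. *)
apply/cvgn_distP => e e0; have e40 : 0 < e / 4 by rewrite divr_gt0.
have [N HN] := tailM _ e40.
have /cvgn_distP/(_ _ e40)[N1 HN1] := lS.
have /cvgn_distP/(_ _ e40)[N2 HN2] := @cvgn_sum _ _ _ N al.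
exists (maxn N (maxn N1 N2)) => n; rewrite !geq_max => /and3P[Nn N1n N2n].
have split_sum (f : nat -> R) :
    \sum_(0 <= k < n) f k = \sum_(0 <= k < N) f k + \sum_(N <= k < n) f k.
  by rewrite (@big_cat_nat _ _ _ N).
have tail (f : nat -> R) : (forall k,
  `|f k| <= M k) -> `|\sum_(N <= k < n) f k| <= e / 4.
  move=> fM; apply: le_trans (ler_norm_sum _ _ _) _.
  by apply: le_trans (HN _ Nn); apply: ler_sum.
have := HN1 _ N1n; have := HN2 _ N2n; have := tail _ (aM n); have := tail _ lM.
rewrite /series /= !split_sum.
by rewrite !ler_norml => /andP[? ?] /andP[? ?] /andP[? ?] /andP[? ?]; apply/andP;
  split; lra.
Qed.

(* The weight n^(3/2) against which coefficient sequences are compared; the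
   shift by one keeps it positive at [n = 0]. *)
Definition wt (R : realType) (n : nat) : R := n.+1%:R * Num.sqrt n.+1%:R.

Section Weight.
Variable R : realType.
Local Notation W := (@wt R).

Lemma wt_gt0 n : 0 < W n. Proof. by rewrite /wt mulr_gt0 // sqrtr_gt0. Qed.

Lemma wt_le (q : R) m n : 0 <= q -> n.+1%:R <= q ^+ 2 * m.+1%:R ->
  W n <= q ^+ 3 * W m.
Proof.
move=> q0 nm; have -> : q ^+ 3 * W m =
  (q ^+ 2 * m.+1%:R) * Num.sqrt (q ^+ 2 * m.+1%:R).
  by rewrite sqrtrM ?sqr_ge0 // sqrtr_sqr ger0_norm // /wt; ring.
by apply: ler_pM => //; rewrite ?sqrtr_ge0 ?ler0n //; exact: ler_wsqrtr.
Qed.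

Lemma wt_sum n : \sum_(0 <= k < n) (W k)^-1 <= 3.
Proof.
(* Telescoping: each further term is at most the difference of two consecutive values of
   [2 / sqrt]. *)
suff H : \sum_(0 <= k < n.+1) (W k)^-1 <= 3 - 2 / Num.sqrt n.+1%:R.
  have := H; rewrite big_nat_recr //= => h.
  apply: le_trans (le_trans h _); first by rewrite lerDl invr_ge0 ltW // wt_gt0.
  by rewrite lerBlDr lerDl divr_ge0 ?sqrtr_ge0.
elim: n => [|n IH]; first by rewrite big_nat1 /wt sqrtr1; lra.
rewrite big_nat_recr //=; apply: le_trans (lerD IH (lexx _)) _.
set a := Num.sqrt n.+1%:R; set b := Num.sqrt n.+2%:R.
have a0 : 0 < a by rewrite sqrtr_gt0.
have b0 : 0 < b by rewrite sqrtr_gt0.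
have a2 : a ^+ 2 = n.+1%:R by rewrite sqr_sqrtr ?ler0n.
have b2 : b ^+ 2 = n.+2%:R by rewrite sqr_sqrtr ?ler0n.
have b2a2 : b ^+ 2 = a ^+ 2 + 1 by rewrite a2 b2 -[n.+2]addn1 natrD.
have -> : W n.+1 = b ^+ 3 by rewrite /wt -/b -b2; ring.
suff : (b ^+ 3)^-1 <= 2 / a - 2 / b by lra.
have ab : a <= b by rewrite ler_wsqrtr // ler_nat.
have -> : 2 / a - 2 / b = 2 / (a * b * (a + b)).
  have ab1 : (b - a) * (a + b) = 1 by ring: b2a2.
  transitivity (2 * ((b - a) * (a + b)) / (a * b * (a + b)));
    last by rewrite ab1 mulr1.
  field; by rewrite !gt_eqF ?addr_gt0.
rewrite ler_pdivlMr ?mulr_gt0 ?addr_gt0 // mulrC ler_pdivrMr ?exprn_gt0 //.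
nra.
Qed.

Lemma cvg_inv_natS k : (fun n : nat => (k%:R / n.+1%:R : R)) @ \oo --> (0 : R).
Proof.
rewrite -[X in _ --> X](mulr0 k%:R); apply: cvgM; first exact: cvg_cst.
exact: cvg_harmonic.
Qed.

Lemma wt_shift k : (fun n => W (n + k) / W n) @ \oo --> (1 : R).
Proof.
have -> : (fun n => W (n + k) / W n) =
    (fun n => (1 + k%:R / n.+1%:R) * Num.sqrt (1 + k%:R / n.+1%:R)).
  apply/funext => n; have e : 1 + k%:R / n.+1%:R = (n + k).+1%:R / n.+1%:R :> R.
    by rewrite -addSn natrD mulrDl divff.
  rewrite e sqrtrM ?ler0n // sqrtrV ?ler0n // /wt.
  have : 0 < n.+1%:R :> R by [].
  move: n.+1%:R (n + k).+1%:R {e} => p q p0; field.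
  by rewrite !gt_eqF ?sqrtr_gt0.
have H : (fun n : nat => (1 + k%:R / n.+1%:R : R)) @ \oo --> (1 : R).
  rewrite -[X in _ --> X]addr0; apply: cvgD; first exact: cvg_cst.
  exact: cvg_inv_natS.
rewrite -[X in _ --> X]mulr1; apply: cvgM => //.
by rewrite -[X in _ --> X]sqrtr1; apply: continuous_cvg => //;
  exact: sqrt_continuous.
Qed.

Lemma wt_unshift k : (fun n => W n / W (n - k)) @ \oo --> (1 : R).
Proof.
rewrite -(cvg_shiftn k); under eq_fun do rewrite addnK; exact: wt_shift.
Qed.
End Weight.

(** * Values at 1 and products of series with coefficients of order n^(-3/2) *)

Section Asymptotics.
Variable R : realType.
Implicit Types f g u : fps R.
Local Notation W := (@wt R).

(** The constant [c] may be 0, which covers the geometrically small series. *)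
Definition asymp f (c : R) := (fun n => fcoef f n * W n) @ \oo --> c.

Definition abs_summable f := exists B, forall n,
  \sum_(0 <= k < n) `|fcoef f k| <= B.

Definition fps_val f : R := limn (series (fcoef f)).

Lemma abs_summable_val f : abs_summable f -> series (fcoef f) @ \oo --> fps_val f.
Proof.
move=> [B fB]; apply: normed_cvg; apply: nondecreasing_is_cvgn.
  by apply: nondecreasing_series => n _ _; exact: normr_ge0.
by exists B => _ [n _ <-]; exact: fB.
Qed.

Lemma asymp_bound f c : asymp f c -> exists2 K, 0 <= K &
  forall n, `|fcoef f n| <= K / W n.
Proof.
move=> /cvgn_bounded[K K0 fK]; exists K => // n.
rewrite ler_pdivlMr ?wt_gt0 //; apply: le_trans (fK n).
by rewrite normrM (ger0_norm (ltW (wt_gt0 R n))).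
Qed.

Lemma asymp_summable f c : asymp f c -> abs_summable f.
Proof.
move=> /asymp_bound[K K0 fK]; exists (K * 3) => n.
apply: le_trans (_ : \sum_(0 <= k < n) K * (W k)^-1 <= _); first exact: ler_sum.
by rewrite -mulr_sumr ler_wpM2l // wt_sum.
Qed.

Lemma asymp_val f c : asymp f c -> series (fcoef f) @ \oo --> fps_val f.
Proof. by move=> /asymp_summable/abs_summable_val. Qed.

Lemma fps_val_uniq f l : series (fcoef f) @ \oo --> l -> fps_val f = l.
Proof. exact: cvg_lim. Qed.

Lemma asympD f g c d : asymp f c -> asymp g d -> asymp (f + g) (c + d).
Proof.
by move=> fc gd; rewrite /asymp; under eq_fun do rewrite fcoefD mulrDl; exact: cvgD.
Qed.

Lemma asympN f c : asymp f c -> asymp (- f) (- c).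
Proof.
by move=> fc; rewrite /asymp; under eq_fun do rewrite fcoefN mulNr; exact: cvgN.
Qed.

Lemma fps_valD f g : abs_summable f -> abs_summable g ->
  fps_val (f + g) = fps_val f + fps_val g.
Proof.
move=> /abs_summable_val fv /abs_summable_val gv; apply: fps_val_uniq.
have -> : series (fcoef (f + g)) = series (fcoef f) \+ series (fcoef g).
  by apply/funext => n; rewrite /series /= -big_split.
exact: cvgD.
Qed.

Lemma fps_valN f : abs_summable f -> fps_val (- f) = - fps_val f.
Proof.
move=> /abs_summable_val fv; apply: fps_val_uniq.
have -> : series (fcoef (- f)) = (fun n => - series (fcoef f) n).
  by apply/funext => n; rewrite /series /= -sumrN.
exact: cvgN.
Qed.

(* Each half of the convolution is dominated, since [n - k >= n / 2] there. *)
Lemma half_convolution f g d (p : nat -> nat -> bool) :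
  (forall n k, p n k -> (2 * k <= n)%N) ->
  (forall k, exists N, forall n, (N <= n)%N -> p n k) ->
  abs_summable f -> asymp g d ->
  (fun n => \sum_(0 <= k < n.+1 | p n k) fcoef f k * fcoef g (n - k) * W n)
    @ \oo --> fps_val f * d.
Proof.
move=> p2 pN fs gd; have [K K0 gK] := asymp_bound gd; have [B fB] := fs.
pose a n k := if (k <= n)%N && p n k then fcoef f k * fcoef g (n - k) * W n else 0.
(* The index [n.+1.-1] turns the sum of [n.+1] terms into a shift of the sums treated by
   [tannery]. *)
have -> : (fun n => \sum_(0 <= k < n.+1 | p n k) fcoef f k * fcoef g (n - k) * W n)
    = (fun n => (\sum_(0 <= k < n.+1) a n.+1.-1 k)).
  apply/funext => n; rewrite big_mkcond /=; apply: eq_big_nat => k /andP[_].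
  by rewrite ltnS /a => ->.
rewrite (cvg_shiftS (fun n => \sum_(0 <= k < n) a n.-1 k)).
apply: (@tannery _ _ (fun k => `|fcoef f k| * (4 * K)) (fun k =>
  fcoef f k * d) (B * (4 * K))).
- move=> n k; rewrite /a; case: ifP => [/andP[kn /p2 kn2]|_]; last first.
    by rewrite normr0 mulr_ge0 // mulr_ge0.
  rewrite -mulrA normrM ler_wpM2l // normrM (ger0_norm (ltW (wt_gt0 R n.-1))).
  have Wm := wt_gt0 R (n.-1 - k).
  apply: le_trans (_ : K / W (n.-1 - k) * (4 * W (n.-1 - k)) <= _); last first.
    by rewrite mulrCA divfK ?gt_eqF.
  apply: ler_pM => //; first by rewrite ltW // wt_gt0.
  (* The ratio 3/2 works because its square exceeds 2 and its cube is below 4. *)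
  apply: le_trans (@wt_le _ (3 / 2) (n.-1 - k) n.-1 _ _) _; first by lra.
    suff : (n.-1.+1%:R : R) <= 2 * (n.-1 - k).+1%:R.
      by have : 0 <= (n.-1 - k).+1%:R :> R by []; lra.
    by rewrite -natrM ler_nat; lia.
  by rewrite ler_wpM2r ?ltW // ; lra.
- by move=> n; rewrite -mulr_suml ler_wpM2r // mulr_ge0.
- move=> k; have [N pk] := pN k.
  rewrite -cvg_shiftS /=.
  have -> : fcoef f k * d = fcoef f k * (d * 1) by rewrite mulr1.
  apply: (@cvg_trans _ ((fun n => fcoef f k * ((fcoef g (n - k) * W (n - k)) * (W
    n / W (n - k)))) @ \oo)).
    apply: near_eq_cvg; exists (maxn N k) => // n;
      rewrite /= geq_max => /andP[Nn kn].
    rewrite /a kn pk //=; have := wt_gt0 R (n - k).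
    by move: (W n) (W (n - k)) => w w' w'0; field; rewrite gt_eqF.
  apply: cvgM; first exact: cvg_cst.
  apply: cvgM; last exact: wt_unshift.
  by rewrite -(cvg_shiftn k); under eq_fun do rewrite addnK.
- have -> : series (fun k => fcoef f k * d) = (fun n => series (fcoef f) n * d).
    by apply/funext => n; rewrite /series /= mulr_suml.
  by apply: cvgM; [exact: abs_summable_val|exact: cvg_cst].
Qed.

(** The main terms of the convolution have one index bounded and the other near [n]; each end
    contributes the value of one factor times the constant of the other. One half is taken strict,
    so that a middle term is counted once. *)
Lemma asympM f g c d : asymp f c -> asymp g d ->
  asymp (f * g) (fps_val f * d + fps_val g * c).
Proof.
move=> fc gd.
have := cvgD (@half_convolution f g d (fun n k =>
  2 * k <= n)%N _ _ (asymp_summable fc) gd)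
  (@half_convolution g f c (fun n k => 2 * k < n)%N _ _ (asymp_summable gd) fc).
move=> H; rewrite /asymp.
have -> : (fun n => fcoef (f * g) n * W n) =
  ((fun n => \sum_(0 <= k < n.+1 | (2 * k <= n)%N) fcoef f k * fcoef g (n - k) *
    W n) \+
   (fun n => \sum_(0 <= k < n.+1 | (2 * k < n)%N) fcoef g k * fcoef f (n - k) * W
     n)).
  apply/funext => n; rewrite fcoefM mulr_suml /= -(big_mkord xpredT (fun i =>
    fcoef f i * fcoef g (n - i) * W n)).
  rewrite (bigID (fun k => 2 * k <= n)%N) /=; congr (_ + _).
  rewrite big_nat_rev /= add0n [LHS]big_nat_cond [RHS]big_nat_cond.
  apply: eq_big => k; first by rewrite subSS; lia.
  by move=> /andP[kn _]; rewrite subSS subKn 1?[fcoef f _ * _]mulrC //; lia.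
apply: H => //.
- by move=> k; exists (2 * k)%N.
- by move=> n k; exact: ltnW.
- by move=> k; exists (2 * k).+1.
Qed.

Lemma sum_convolution f g n : \sum_(0 <= m < n) fcoef (f * g) m =
  \sum_(0 <= k < n) fcoef f k * \sum_(0 <= j < n - k) fcoef g j.
Proof.
elim: n => [|n IH]; first by rewrite !big_nil.
rewrite big_nat_recr // IH [in RHS]big_nat_recr //= subSn // subnn big_nat1.
rewrite -(big_mkord xpredT (fun i =>
  fcoef f i * fcoef g (n - i))) big_nat_recr //= subnn addrA.
congr (_ + _); rewrite -big_split /=; apply: eq_big_nat => k /andP[_ kn].
by rewrite -mulrDr subSn ?(ltnW kn) // big_nat_recr.
Qed.

Lemma fps_valM f g : abs_summable f -> abs_summable g ->
  fps_val (f * g) = fps_val f * fps_val g.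
Proof.
move=> fs gs; apply: fps_val_uniq; have [B fB] := fs; have [C gC] := gs.
have gC' n : `|\sum_(0 <= j < n) fcoef g j| <= C.
  by apply: le_trans (gC n); exact: ler_norm_sum.
have C0 : 0 <= C by apply: le_trans (gC' 0%N).
have -> : series (fcoef (f * g)) =
    (fun n => \sum_(0 <= k < n) fcoef f k * \sum_(0 <= j < n - k) fcoef g j).
  by apply/funext => n; rewrite /series /= sum_convolution.
apply: (@tannery _ _ (fun k => `|fcoef f k| * C) (fun k =>
  fcoef f k * fps_val g) (B * C)).
- by move=> n k; rewrite normrM ler_wpM2l.
- by move=> n; rewrite -mulr_suml ler_wpM2r.
- move=> k; apply: cvgM; first exact: cvg_cst.
  rewrite -(cvg_shiftn k); under eq_fun do rewrite addnK.
  exact: abs_summable_val gs.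
- have -> : series (fun k => fcoef f k * fps_val g) = (fun n =>
  series (fcoef f) n * fps_val g).
    by apply/funext => n; rewrite /series /= mulr_suml.
  by apply: cvgM; [exact: abs_summable_val|exact: cvg_cst].
Qed.
End Asymptotics.

(** * Subcritical renewal *)

Section Renewal.
Variable R : realType.
Local Notation W := (@wt R).
Variables (g u : fps R) (d : R).
Hypothesis g_ge0 : forall n, 0 <= fcoef g n.
Hypothesis g00 : fcoef g 0 = 0.
Hypothesis g_asymp : asymp g d.
Hypothesis g_val : fps_val g <= 3 / 4.
Hypothesis u_eq : u = 1 + g * u.
Let G := fps_val g.

Let fcoef_u n : fcoef u n = (n == 0%N)%:R +
  \sum_(0 <= k < n.+1) fcoef g k * fcoef u (n - k).
Proof. by rewrite {1}u_eq fcoefD fcoefM big_mkord. Qed.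

Lemma renewal_ge0 n : 0 <= fcoef u n.
Proof.
have [m] := ubnP n; elim: m n => // m IH n; rewrite ltnS => nm.
rewrite fcoef_u addr_ge0 // big_nat; apply: sumr_ge0 => -[|k] kn.
  by rewrite g00 mul0r.
by rewrite mulr_ge0 // IH //; lia.
Qed.

Let sum_g n : \sum_(0 <= k < n) fcoef g k <= G.
Proof.
have gv := asymp_val g_asymp.
rewrite /G -(cvg_lim _ gv) //; apply: nondecreasing_cvgn_le.
  by apply: nondecreasing_series => k _ _.
by apply/cvg_ex; exists (fps_val g).
Qed.

Lemma renewal_sum n : \sum_(0 <= k < n) fcoef u k <= 4.
Proof.
set S := \sum_(_ <= _ < _) _.
have S0 : 0 <= S by apply: sumr_ge0 => k _; exact: renewal_ge0.
(* The partial sums of [u = 1 + g * u] satisfy [S <= 1 + G * S]. *)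
suff : S <= 1 + 3 / 4 * S by lra.
rewrite {1}/S u_eq (eq_bigr (fun k => (k == 0%N)%:R + fcoef (g * u) k)) //.
rewrite big_split /= lerD //.
  case: n {S S0} => [|n]; first by rewrite big_nil.
  by rewrite big_nat_recl // big1 ?addr0.
rewrite (sum_convolution g u); apply: le_trans (_ : G * S <= _); last first.
  by rewrite ler_wpM2r.
apply: le_trans (_ : \sum_(0 <= k < n) fcoef g k * S <= _); last first.
  by rewrite -mulr_suml ler_wpM2r.
apply: ler_sum => k _; rewrite ler_wpM2l // /S [leRHS](@big_cat_nat _ _ _ (n -
  k)) ?leq_subr //=.
by rewrite lerDl; apply: sumr_ge0 => j _; exact: renewal_ge0.
Qed.

Let u_summable : abs_summable u.
Proof.
exists 4 => n; under eq_bigr do rewrite ger0_norm ?renewal_ge0 //.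
exact: renewal_sum.
Qed.

Lemma renewal_val : fps_val u * (1 - G) = 1.
Proof.
have one_summable : abs_summable (1 : fps R).
  exists 1 => -[|n]; first by rewrite big_nil.
  by rewrite big_nat_recl //= normr1 big1 ?addr0 // => i _; rewrite normr0.
have gs := asymp_summable g_asymp.
have gu_summable : abs_summable (g * u).
  exists 4 => n; apply: le_trans (renewal_sum n); apply: ler_sum => k _.
  rewrite [in leRHS]u_eq fcoefD ger0_norm ?lerDr ?ler0n //.
  by rewrite fcoefM; apply: sumr_ge0 => j _; rewrite mulr_ge0 // renewal_ge0.
have : fps_val u = fps_val (1 : fps R) + G * fps_val u.
  by rewrite {1}u_eq fps_valD // fps_valM.
have -> : fps_val (1 : fps R) = 1; last by move=> h; rewrite mulrBr mulr1 {1}h;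
  ring.
apply: fps_val_uniq; rewrite -cvg_shiftS /=.
have -> : (fun n : nat => series (fcoef (1 : fps R)) n.+1) = cst 1;
  last exact: cvg_cst.
by apply/funext => n; rewrite /series /= big_nat_recl // big1 ?addr0.
Qed.

(* For [k <= n / 12] the weights [W n] and [W (n - k)] differ by a factor at most
   7/6, and [7/6 * 3/4 < 1]. *)
Lemma renewal_bounded : exists2 M, 0 <= M & forall n, fcoef u n * W n <= M.
Proof.
have [K K0 gK] := asymp_bound g_asymp.
(* [M] solves [M = 1 + 7/8 M + 256 K]: here 7/8 is [7/6 * 3/4], and 256 is the weight ratio [4 ^+ 3]
   of the large [k] times the bound 4 on the sums of [u]. *)
have [M ME] : exists M, M = 8 * (1 + 256 * K) by exists (8 * (1 + 256 * K)).
exists M => [|n]; first by lra.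
have [m] := ubnP n; elim: m n => // m IH n; rewrite ltnS => nm.
have term k : (k <= n)%N -> fcoef g k * fcoef u (n - k) * W n <=
    fcoef g k * (7 / 6 * M) + 64 * K * fcoef u (n - k).
  move=> kn; have u0 := renewal_ge0 (n - k).
  have M0 : 0 <= M by lra.
  have [k12|k12] := leqP (12 * k) n.
    case: k kn u0 k12 => [|k] kn u0 k12.
      by rewrite g00 !mul0r add0r mulr_ge0 // mulr_ge0.
    rewrite -mulrA; apply: ler_wpDr; first by rewrite mulr_ge0 // mulr_ge0.
    rewrite ler_wpM2l //; have uM : fcoef u (n - k.+1) * W (n - k.+1) <= M by
      apply: IH; lia.
    (* The square of 21/20 exceeds 12/11 and its cube is below 7/6. *)
    have : W n <= (21 / 20) ^+ 3 * W (n - k.+1).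
      apply: wt_le; first by lra.
      suff : (11 * n.+1)%:R <= (12 * (n - k.+1).+1)%:R :> R.
        by rewrite !natrM; have : 0 <= (n - k.+1).+1%:R :> R by []; lra.
      by rewrite ler_nat; lia.
    have Wp := wt_gt0 R (n - k.+1).
    move=> /(ler_wpM2l u0) h; apply: le_trans h _.
    rewrite mulrCA; apply: ler_pM => //; last by lra.
      by rewrite mulr_ge0 // ltW.
  have : W n <= 4 ^+ 3 * W k.
    apply: wt_le; first by lra.
    suff : (n.+1)%:R <= (16 * k.+1)%:R :> R by rewrite natrM; lra.
    by rewrite ler_nat; lia.
  have := gK k; rewrite ger0_norm // ler_pdivlMr ?wt_gt0 // => gW Wn.
  apply: ler_wpDl; first by rewrite mulr_ge0 // mulr_ge0 //; lra.
  rewrite mulrAC ler_wpM2r //; apply: le_trans (ler_wpM2l (g_ge0 k) Wn) _.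
  by rewrite mulrCA; apply: ler_pM => //; [rewrite mulr_ge0 // ltW // wt_gt0|lra].
rewrite fcoef_u mulrDl mulr_suml.
have h0 : (n == 0%N)%:R * W n <= 1.
  by case: n {nm term} => [|n]; rewrite /= ?mul0r ?ler01 // mul1r /wt sqrtr1 mulr1.
have h1 : \sum_(0 <= k < n.+1) fcoef g k * fcoef u (n - k) * W n <=
    7 / 6 * M * G + 64 * K * 4.
  apply: le_trans (_ : \sum_(0 <= k < n.+1)
     (fcoef g k * (7 / 6 * M) + 64 * K * fcoef u (n - k)) <= _).
    by rewrite !big_nat; apply: ler_sum => k kn; apply: term; lia.
  rewrite big_split /= -mulr_suml -mulr_sumr [_ * (7 / 6 * M)]mulrC lerD //.
    by rewrite ler_wpM2l //; lra.
  rewrite ler_wpM2l ?mulr_ge0 // big_nat_rev /= add0n.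
  apply: le_trans (renewal_sum n.+1); rewrite !big_nat; apply: ler_sum => k kn.
  by rewrite subSS subKn //; lia.
have : 7 / 6 * M * G <= 7 / 6 * M * (3 / 4) by rewrite ler_wpM2l //; lra.
by move: h0 h1; lra.
Qed.

(** The limit [l] is the fixed point of [l = d * U + G * l]. Boundedness of [v] turns the recurrence
    into a contraction: the error at [n] is at most 3/4 of the errors at indices from [n / 2] on,
    plus a null sequence. *)
Lemma renewal_asymp : asymp u (d * fps_val u ^+ 2).
Proof.
have [M M0 uM] := renewal_bounded.
set l := d * _; pose U := fps_val u.
pose v n := fcoef u n * W n.
have v0 n : 0 <= v n by rewrite mulr_ge0 ?renewal_ge0 // ltW // wt_gt0.
have lE : l = d * U + G * l.
  rewrite /l -/U; have : d * U * (U * (1 - G)) = d * U by rewrite renewal_val mulr1.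
  by move=> <-; ring.
pose X n := \sum_(0 <= k < n.+1 | (2 * k < n)%N) fcoef u k * fcoef g (n - k) * W n.
have Xl : X @ \oo --> U * d.
  apply: (@half_convolution R u g d (fun n k => 2 * k < n)%N) => //.
  - by move=> n k; exact: ltnW.
  - by move=> k; exists (2 * k).+1.
(* What remains of the terms [k <= n / 2] once [v (n - k) - l] is split off: the change of weight,
   which tends to 0, and the limit. *)
pose y n k := fcoef g k * (v (n - k)%N * (W n / W (n - k) - 1) + l).
pose Y n := \sum_(0 <= k < n.+1 | (2 * k <= n)%N) y n k.
have Yl : Y @ \oo --> G * l.
  pose a n k := if (k <= n)%N && (2 * k <= n)%N then y n k else 0.
  have -> : Y = (fun n => (\sum_(0 <= k < n.+1) a n.+1.-1 k)).
    apply/funext => n; rewrite /Y big_mkcond /=; apply: eq_big_nat => k /andP[_].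
    by rewrite ltnS /a => ->.
  rewrite (cvg_shiftS (fun n => \sum_(0 <= k < n) a n.-1 k)).
  apply: (@tannery _ _ (fun k => fcoef g k * (4 * M + `|l|)) (fun k =>
    fcoef g k * l)
     (G * (4 * M + `|l|))).
  - move=> n k; rewrite /a; case: ifP => [/andP[kn k2]|_]; last first.
      by rewrite normr0 mulr_ge0 // addr_ge0 // mulr_ge0.
    rewrite /y normrM ger0_norm // ler_wpM2l // (le_trans (ler_normD _ _)) //
      lerD2r.
    have Wk := wt_gt0 R (n.-1 - k); have Wn := wt_gt0 R n.-1.
    rewrite normrM ger0_norm // [4 * M]mulrC; apply: ler_pM => //; first exact: uM.
    have : 0 <= W n.-1 / W (n.-1 - k) by rewrite divr_ge0 // ltW.
    have : W n.-1 / W (n.-1 - k) <= 4; last by rewrite ler_norml; lra.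
    rewrite ler_pdivrMr //; apply: le_trans (@wt_le _ (3 / 2) (n.-1 - k) n.-1 _
      _) _; first by lra.
      suff : (n.-1.+1%:R : R) <= 2 * (n.-1 - k).+1%:R.
        by have : 0 <= (n.-1 - k).+1%:R :> R by []; lra.
      by rewrite -natrM ler_nat; lia.
    by rewrite ler_wpM2r ?ltW //; lra.
  - by move=> n; rewrite -mulr_suml ler_wpM2r // addr_ge0 // mulr_ge0.
  - move=> k; rewrite -cvg_shiftS /=.
    apply: (@cvg_trans _ ((fun n => y n k) @ \oo)).
      apply: near_eq_cvg; exists (2 * k)%N => // n /= kn.
      by rewrite /a kn andbT ifT //; lia.
    rewrite /y; apply: cvgM; first exact: cvg_cst.
    rewrite -[X in _ --> X]add0r; apply: cvgD; last exact: cvg_cst.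
    have /cvgn_distP r1 := @wt_unshift R k.
    apply/cvgn_distP => e e0; have M1 : 0 < M + 1 by lra.
    have [|N HN] := r1 (e / (M + 1)); first exact: divr_gt0.
    exists N => n /HN; rewrite sub0r normrN normrM ger0_norm // distrC
      ler_pdivlMr // => h.
    apply: le_trans h; rewrite mulrC ler_wpM2l //.
    by apply: le_trans (uM _) _; lra.
  - have -> : series (fun k => fcoef g k * l) = (fun n => series (fcoef g) n * l).
      by apply/funext => n; rewrite /series /= mulr_suml.
    by apply: cvgM; [exact: asymp_val g_asymp|exact: cvg_cst].
have vE n : (0 < n)%N -> v n - l =
    \sum_(0 <= k < n.+1 | (2 * k <= n)%N) fcoef g k * (v (n - k)%N - l)
    + (X n - U * d) + (Y n - G * l).
  move=> n0; have vXY : v n = X n +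
    \sum_(0 <= k < n.+1 | (2 * k <= n)%N) fcoef g k * fcoef u (n - k) * W n.
    rewrite /v fcoef_u (gtn_eqF n0) add0r mulr_suml (bigID (fun k =>
      2 * k <= n)%N) /= addrC.
    congr (_ + _); rewrite /X big_nat_rev /= add0n [LHS]big_nat_cond
      [RHS]big_nat_cond.
    apply: eq_big => k; first by rewrite subSS; lia.
    by move=> /andP[kn _]; rewrite subSS subKn 1?[fcoef g _ * _]mulrC //; lia.
  rewrite vXY.
  have -> : \sum_(0 <= k < n.+1 | (2 * k <= n)%N) fcoef g k * fcoef u (n - k) * W
    n =
     \sum_(0 <= k < n.+1 | (2 * k <= n)%N) fcoef g k * (v (n - k)%N - l) + Y n.
    rewrite /Y -big_split /=; apply: eq_bigr => k _; rewrite /y /v.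
    have := wt_gt0 R (n - k).
    by move: (W n) (W (n - k)) => w w' w'0; field; rewrite gt_eqF.
  by move: (\sum_(_ <= _ < _ | _) _) lE => S; lra.
pose D := M + `|l| + 1.
(* The factor is 3/4 + 1/16 + 1/16 = 7/8; the threshold [N] doubles at each stage because
   [n - k >= n / 2]. *)
have contraction m : exists N, forall n,
  (N <= n)%N -> `|v n - l| <= (7 / 8) ^+ m * D.
  elim: m => [|m [N HN]].
    exists 0%N => n _; rewrite expr0 mul1r; apply: le_trans (ler_normB _ _) _.
    by rewrite ger0_norm // /D; have := uM n; rewrite -/(v n); lra.
  set b := (7 / 8) ^+ m * D in HN.
  have b0 : 0 < b.
    have D0 : 0 < D by rewrite /D; have := normr_ge0 l; lra.
    by rewrite mulr_gt0 // exprn_gt0.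
  have b16 : 0 < b / 16 by rewrite divr_gt0.
  have /cvgn_distP/(_ _ b16)[N1 HN1] := Xl.
  have /cvgn_distP/(_ _ b16)[N2 HN2] := Yl.
  exists (maxn (2 * N).+1 (maxn N1 N2)) => n;
    rewrite !geq_max => /and3P[Nn N1n N2n].
  rewrite vE; last by lia.
  rewrite exprS -mulrA -/b.
  have h : `|\sum_(0 <= k < n.+1 | (2 * k <= n)%N) fcoef g k * (v (n - k)%N - l)|
    <= 3 / 4 * b.
    apply: le_trans (ler_norm_sum _ _ _) _.
    apply: le_trans (_ : \sum_(0 <= k < n.+1) fcoef g k * b <= _); last first.
      by rewrite -mulr_suml (ler_wpM2r (ltW b0)) // (le_trans (sum_g _)).
    rewrite big_mkcond /=; apply: ler_sum => k _; case: ifP => k2; last first.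
      by rewrite mulr_ge0 // ltW.
    by rewrite normrM ger0_norm // ler_wpM2l // HN //; lia.
  have := HN1 _ N1n; have := HN2 _ N2n; move: h; rewrite !ler_norml.
  by move=> /andP[? ?] /andP[? ?] /andP[? ?]; apply/andP; split; lra.
apply/cvgn_distP => e e0.
have /cvgn_distP/(_ _ e0)[m Hm] : (fun m => (7 / 8) ^+ m * D) @ \oo --> (0 : R).
  rewrite -(mul0r D); apply: cvgM; last exact: cvg_cst.
  by apply: cvg_expr; rewrite ger0_norm; lra.
have [N HN] := contraction m; exists N => n /HN h; rewrite distrC.
apply: le_trans h _; apply: le_trans (ler_norm _) _.
by have := Hm _ (leqnn m); rewrite sub0r normrN.
Qed.
End Renewal.

(** * The coefficients of the square root *)

Section Wallis.
Variable R : realType.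

(* The reduction formula for the antiderivative of [cos ^+ n]. *)
Fixpoint cosn_primitive (n : nat) : R -> R :=
  match n with
  | 0 => id
  | m.+1 =>
    match m with
    | 0 => sin
    | k.+1 => fun x =>
        (k.+2%:R)^-1 * (cos x ^+ k.+1 * sin x + k.+1%:R * cosn_primitive k x)
    end
  end.

Lemma is_derive_cosn_primitive (n : nat) (x : R) : is_derive x 1 (cosn_primitive
  n) (cos x ^+ n).
Proof.
have [m] := ubnP n; elim: m n => // m IH [|[|k]] nm.
- by rewrite expr0; exact: is_derive_id.
- by rewrite expr1; exact: is_derive_sin.
- have IHk : is_derive x 1 (cosn_primitive k) (cos x ^+ k) by apply: IH; lia.
  have -> : cosn_primitive k.+2 = k.+2%:R^-1 \*: ((@cos R) ^+ k.+1 * (@sin R) +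
    k.+1%:R \*: cosn_primitive k).
    by apply/funext => y; rewrite /GRing.scale /= fctE exprfctE.
  have D1 := is_deriveX k.+1 (is_derive_cos x).
  have D2 := is_deriveM D1 (is_derive_sin x).
  have D3 := is_deriveD D2 (is_deriveZ k.+1%:R IHk).
  have D4 := is_deriveZ (k.+2%:R)^-1 D3.
  apply: (is_derive_eq D4).
  rewrite /GRing.scale /= exprfctE.
  have s2 : sin x ^+ 2 = 1 - cos x ^+ 2 by rewrite -(cos2Dsin2 x); ring.
  have -> : sin x * (k.+1%:R * cos x ^+ k * - sin x) =
    - k.+1%:R * cos x ^+ k * sin x ^+ 2 by ring.
  rewrite s2 !exprS -[k.+2]addn1 natrD; field.
  by rewrite gt_eqF //; have : 0 <= k%:R :> R by []; lra.
Qed.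

Lemma cosn_primitive0 n : cosn_primitive n 0 = 0.
Proof.
have [m] := ubnP n; elim: m n => // m IH [|[|k]] nm //=; first exact: sin0.
by rewrite sin0 IH ?mulr0 ?addr0 ?mulr0 //; lia.
Qed.

(** The integral of [cos ^+ n] over [[0, pi / 2]], as the primitive vanishes at 0. *)
Definition wallis n := cosn_primitive n (pi / 2).

Lemma wallis0 : wallis 0 = pi / 2. Proof. by []. Qed.
Lemma wallis1 : wallis 1 = 1. Proof. exact: sin_pihalf. Qed.
Lemma wallisSS n : wallis n.+2 = n.+1%:R / n.+2%:R * wallis n.
Proof. by rewrite /wallis /= cos_pihalf exprS !mul0r add0r; ring. Qed.

Lemma wallis_gt0 n : 0 < wallis n.
Proof.
have [m] := ubnP n; elim: m n => // m IH [|[|k]] nm.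
- by rewrite wallis0 divr_gt0 // pi_gt0.
- by rewrite wallis1.
- by rewrite wallisSS mulr_gt0 ?divr_gt0 // IH //; lia.
Qed.

Lemma wallis_decr n : wallis n.+1 <= wallis n.
Proof.
have pi0 : 0 <= pi / 2 :> R by rewrite divr_ge0 // pi_ge0.
pose f := cosn_primitive n - cosn_primitive n.+1.
have df (x : R) : is_derive x 1 f (cos x ^+ n - cos x ^+ n.+1).
  by apply: is_deriveB; exact: is_derive_cosn_primitive.
have : f 0 <= f (pi / 2).
  apply: (@ger0_derive1_le_cc _ f 0 (pi / 2)); rewrite ?in_itv /= ?lexx ?pi0 //.
  - move=> x; rewrite in_itv /= => /andP[x0 xp].
    rewrite derive1E derive_val exprS -[X in X - _]mul1r -mulrBl mulr_ge0
      ?subr_ge0 ?cos_le1 //.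
    rewrite exprn_ge0 // cos_ge0_pihalf // (ltW xp) andbT; lra.
  - apply: continuous_subspaceT => x; apply: differentiable_continuous.
    by apply/derivable1_diffP.
have fE y : f y = cosn_primitive n y - cosn_primitive n.+1 y by [].
by rewrite !fE !cosn_primitive0 subrr subr_ge0.
Qed.

Lemma wallis_prod n : wallis n * wallis n.+1 * n.+1%:R = pi / 2.
Proof.
elim: n => [|n IH]; first by rewrite wallis0 wallis1 !mulr1.
by rewrite -IH wallisSS; field.
Qed.
End Wallis.

(** * The series of square roots of linear polynomials *)

Section SqrtCoef.
Variable R : realType.
Local Notation W := (@wt R).

(* Coefficients of [sqrt (1 - X)]. *)
Fixpoint sqrt_coef (n : nat) : R :=
  if n is m.+1 then sqrt_coef m * (2 * m%:R - 1) / (2 * m.+1%:R) else 1.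

Definition sqrt_lin (a : R) : fps R := Fps (fun n => sqrt_coef n * a ^+ n).

Lemma sqrt_linS a n : 2 * n.+1%:R * fcoef (sqrt_lin a) n.+1 =
  a * ((2 * n%:R - 1) * fcoef (sqrt_lin a) n).
Proof. by rewrite /= exprS; field. Qed.

(* [f = sqrt_lin a] satisfies [2 (1 - a X) X f' = - a X f], so the coefficients
   of [f ^+ 2] satisfy [n c_n = a (n - 2) c_(n-1)] and vanish from [c_2] on. *)
Lemma sqrt_lin_sqr a : sqrt_lin a ^+ 2 = 1 - Fps (fun n => a *+ (n == 1%N)).
Proof.
set s := sqrt_lin a; pose c n := fcoef (s * s) n.
have cE n : c n = \sum_(0 <= k < n.+1) fcoef s k * fcoef s (n - k).
  by rewrite /c fcoefM big_mkord.
have euler n : n%:R * c n = \sum_(0 <= k < n.+1) 2 * k%:R * fcoef s k * fcoef s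
  (n - k).
  have rev : \sum_(0 <= k < n.+1) k%:R * (fcoef s k * fcoef s (n - k)) =
      \sum_(0 <= k < n.+1) (n - k)%:R * (fcoef s k * fcoef s (n - k)).
    rewrite big_nat_rev /= add0n; apply: eq_big_nat => k kn.
    by rewrite subSS subKn; [ring|lia].
  have -> : \sum_(0 <= k < n.+1) 2 * k%:R * fcoef s k * fcoef s (n - k) =
      \sum_(0 <= k < n.+1) k%:R * (fcoef s k * fcoef s (n - k)) +
      \sum_(0 <= k < n.+1) k%:R * (fcoef s k * fcoef s (n - k)).
    by rewrite -big_split /=; apply: eq_bigr => k _; ring.
  rewrite {2}rev -big_split /= cE mulr_sumr; apply: eq_big_nat => k kn.
  by rewrite natrB; [rewrite /=; ring|lia].
have cS n : n.+1%:R * c n.+1 = a * ((n%:R - 1) * c n).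
  rewrite euler big_nat_recl // mulr0 !mul0r add0r mulrBl mul1r {1}euler cE.
  rewrite -sumrB mulr_sumr; apply: eq_big_nat => k kn.
  by rewrite subSS sqrt_linS; ring.
have c0 : c 0%N = 1 by rewrite cE big_nat1 /= expr0; ring.
have c1 : c 1%N = - a by have := cS 0%N; rewrite c0; lra.
have c2 n : c n.+2 = 0.
  elim: n => [|n IH].
    by have /eqP := cS 1%N; rewrite /= subrr mul0r mulr0 mulf_eq0 pnatr_eq0 => /eqP.
  by have /eqP := cS n.+2; rewrite IH !mulr0 mulf_eq0 pnatr_eq0 => /eqP.
apply: fpsP => n; rewrite expr2 -/(c n) fcoefD fcoefN fcoef1 /=.
by case: n => [|[|n]]; rewrite ?c0 ?c1 ?c2 /=; ring.
Qed.

(** The central binomial coefficient [binom(2n, n) / 4^n], coefficient of [1 / sqrt (1 - X)]. *)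
Definition central n := - (2 * n%:R - 1) * sqrt_coef n.

Lemma central0 : central 0 = 1. Proof. by rewrite /central /=; ring. Qed.
Lemma centralS n : central n.+1 = (2 * n).+1%:R / (2 * n).+2%:R * central n.
Proof.
have n0 : 0 <= n%:R :> R by [].
have -> : (2 * n).+2%:R = 2 * n%:R + 2 :> R by rewrite -addn2 natrD natrM.
have -> : (2 * n).+1%:R = 2 * n%:R + 1 :> R by rewrite -addn1 natrD natrM.
rewrite /central /= -[n.+1]addn1 natrD.
by field; apply/andP; split; apply: lt0r_neq0; lra.
Qed.

Lemma centralE n : central n = 2 / pi * wallis R (2 * n).
Proof.
have p0 : pi != 0 :> R by rewrite gt_eqF // pi_gt0.
elim: n => [|n IH]; first by rewrite central0 muln0 wallis0 mulrA divfK // divff.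
by rewrite centralS IH mulnS wallisSS; ring.
Qed.

Lemma central_gt0 n : 0 < central n.
Proof. by rewrite centralE mulr_gt0 ?divr_gt0 ?pi_gt0 ?wallis_gt0. Qed.

Lemma sqrt_coefE n : sqrt_coef n = - central n / (2 * n%:R - 1).
Proof.
rewrite /central; field; rewrite subr_eq0 -natrM -[1]/(1%:R) eqr_nat.
by apply/eqP; lia.
Qed.

(** Partial sums amount to division by [1 - X], and [sqrt (1 - X) / (1 - X) = 1 / sqrt (1 - X)]. *)
Lemma sum_sqrt_coef n : \sum_(0 <= k < n.+1) sqrt_coef k = central n.
Proof.
elim: n => [|n IH]; first by rewrite big_nat1 central0.
rewrite big_nat_recr // IH /central /= -[n.+1]add1n natrD.
by field; apply: lt0r_neq0; have : 0 <= n%:R :> R by []; lra.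
Qed.

(** By monotonicity the square of a Wallis integral lies between its products with the next and with
    the previous one, both known from [wallis_prod]. *)
Lemma central_sqr_bounds n :
  pi^-1 <= central n.+1 ^+ 2 * n.+2%:R <= pi^-1 + pi^-1 * harmonic n.
Proof.
have p0 := pi_gt0 R.
have p0' : pi != 0 :> R by rewrite gt_eqF.
have q0 : n.+1%:R != 0 :> R by rewrite pnatr_eq0.
have w0 := wallis_gt0 R (2 * n.+1); have w1 := wallis_gt0 R (2 * n.+1).+1.
have w2 := wallis_gt0 R (2 * n).+1.
have d1 := wallis_decr R (2 * n.+1); have d2 := wallis_decr R (2 * n).+1.
have e1 := wallis_prod R (2 * n.+1); have e2 := wallis_prod R (2 * n).+1.
rewrite centralE.
have n2 : (2 * n).+2 = (2 * n.+1)%N by lia.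
rewrite n2 in d2 e2.
move: (wallis R (2 * n.+1)) w0 d1 d2 e1 e2 => w w0 d1 d2 e1 e2.
have h1 : pi / 2 <= w ^+ 2 * (2 * n.+1).+1%:R.
  by rewrite -e1 ler_wpM2r // expr2 ler_wpM2l // ltW.
have h2 : w ^+ 2 * (2 * n.+1)%:R <= pi / 2.
  by rewrite -e2 ler_wpM2r // expr2 ler_wpM2r // ltW.
apply/andP; split.
  have -> : (2 / pi * w) ^+ 2 * n.+2%:R = (2 / pi ^+ 2) * (w ^+ 2 * (2 * n.+2)%:R).
    by rewrite natrM; move: (pi : R) p0' => p p'0; field.
  have -> : pi^-1 = (2 / pi ^+ 2) * (pi / 2) :> R by move: (pi : R) p0' => p p'0;
    field.
  rewrite ler_wpM2l ?divr_ge0 ?exprn_ge0 ?pi_ge0 //; apply: le_trans h1 _.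
  by rewrite (ler_wpM2l (exprn_ge0 2 (ltW w0))) // ler_nat; lia.
have -> : pi^-1 + pi^-1 * harmonic n =
  (2 / pi ^+ 2) * (pi / 2) * (n.+2%:R / n.+1%:R) :> R.
  rewrite /harmonic /= -[n.+2]addn1 natrD.
  by move: (pi : R) p0' (n.+1%:R : R) q0 => p p'0 q q0; field; rewrite q0 p'0.
have -> : (2 / pi * w) ^+ 2 * n.+2%:R =
    (2 / pi ^+ 2) * (w ^+ 2 * (2 * n.+1)%:R) * (n.+2%:R / n.+1%:R).
  rewrite natrM.
  by move: (pi : R) p0' (n.+2%:R : R) (n.+1%:R : R) q0 => p p'0 r q q0; field;
    rewrite q0 p'0.
by rewrite ler_wpM2r ?divr_ge0 // ler_wpM2l ?divr_ge0 ?exprn_ge0 ?pi_ge0.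
Qed.

Lemma cvg_central : (fun n => central n * Num.sqrt n.+1%:R) @ \oo --> (Num.sqrt
  pi)^-1.
Proof.
rewrite -cvg_shiftS /=.
have -> : (fun n => central n.+1 * Num.sqrt n.+2%:R) =
   (fun n => Num.sqrt (central n.+1 ^+ 2 * n.+2%:R)).
  by apply/funext => n; rewrite sqrtrM ?sqr_ge0 // sqrtr_sqr ger0_norm // ltW //
    central_gt0.
rewrite -sqrtrV ?pi_ge0 //.
apply: continuous_cvg; first exact: sqrt_continuous.
apply: (@squeeze_cvgr _ _ _ _ (cst pi^-1) (fun n => pi^-1 + pi^-1 * harmonic n)).
- by apply: nearW => n; exact: central_sqr_bounds.
- exact: cvg_cst.
- rewrite -[X in _ --> X]addr0; apply: cvgD; first exact: cvg_cst.
  rewrite -[X in _ --> X](mulr0 pi^-1); apply: cvgM; first exact: cvg_cst.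
  exact: cvg_harmonic.
Qed.

Lemma cvg_central0 : central @ \oo --> (0 : R).
Proof.
apply: (@squeeze_cvgr _ _ _ _ (cst 0) (fun n =>
  central n * Num.sqrt n.+1%:R * (Num.sqrt n.+1%:R)^-1)).
- apply: nearW => n; rewrite mulfK ?gt_eqF ?sqrtr_gt0 // lexx andbT.
  by rewrite ltW // central_gt0.
- exact: cvg_cst.
- rewrite -(mulr0 (Num.sqrt pi)^-1); apply: cvgM; first exact: cvg_central.
  have -> : (fun n : nat => (Num.sqrt n.+1%:R)^-1) = (fun n : nat =>
    Num.sqrt (n.+1%:R^-1)) :> (nat -> R).
    by apply/funext => n; rewrite sqrtrV.
  rewrite -[X in _ --> X]sqrtr0; apply: continuous_cvg;
    first exact: sqrt_continuous.
  exact: cvg_harmonic.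
Qed.

Lemma sqrt_lin1_asymp : asymp (sqrt_lin 1) (- (2 * Num.sqrt pi)^-1).
Proof.
rewrite /asymp -cvg_shiftS /=.
(* With [m = n.+1], the factor [(m + 1) / (2 m - 1)] is [(1 + 3 / (2 m - 1)) / 2]. *)
have -> : (fun n => fcoef (sqrt_lin 1) n.+1 * W n.+1) =
    (fun n => - (2^-1 * (central n.+1 * Num.sqrt n.+2%:R) * (1 +
      3 * (2 * n.+1%:R - 1)^-1))).
  apply/funext => n; rewrite /fcoef /sqrt_lin expr1n mulr1 sqrt_coefE /wt.
  have m1 : 1 <= n.+1%:R :> R by rewrite ler1n.
  rewrite -[n.+2]addn1 natrD; move: (n.+1%:R : R) m1 => m m1.
  by field; apply: lt0r_neq0; lra.
rewrite -[(2 * _)^-1]mulr1 invfM; apply: cvgN; apply: cvgM.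
  apply: cvgM; first exact: cvg_cst.
  by rewrite (cvg_shiftS (fun n => central n * Num.sqrt n.+1%:R));
    exact: cvg_central.
rewrite -[X in _ --> X]addr0; apply: cvgD; first exact: cvg_cst.
rewrite -(mulr0 3); apply: cvgM; first exact: cvg_cst.
apply: (@squeeze_cvgr _ _ _ _ (cst 0) harmonic); last exact: cvg_harmonic.
  apply: nearW => n; have n0 : 0 <= n%:R :> R by [].
  rewrite /harmonic -[n.+1]addn1 natrD invr_ge0; apply/andP; split; first lra.
  by rewrite lef_pV2 ?posrE; lra.
exact: cvg_cst.
Qed.

Lemma sqrt_lin1_val : fps_val (sqrt_lin 1) = 0.
Proof.
apply: fps_val_uniq; rewrite -cvg_shiftS /=.
have -> : (fun n => series (fcoef (sqrt_lin 1)) n.+1) = central;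
  last exact: cvg_central0.
apply/funext => n; rewrite /series /= -sum_sqrt_coef; apply: eq_bigr => k _.
by rewrite expr1n mulr1.
Qed.
End SqrtCoef.

(** * Asymptotics of the number of classes *)

Section Dilation.
Variable R : comNzRingType.

(* The substitution [t -> 3 x ^+ 2]. *)
Definition dilate (f : fps R) : fps R :=
  Fps (fun n => if odd n then 0 else fcoef f n./2 * 3 ^+ n./2).

Lemma dilateD f g : dilate (f + g) = dilate f + dilate g.
Proof. by apply: fpsP => n; rewrite /= ; case: odd; rewrite ?addr0 // mulrDl. Qed.

Lemma dilateN f : dilate (- f) = - dilate f.
Proof. by apply: fpsP => n; rewrite /= ; case: odd; rewrite ?oppr0 // mulNr. Qed.

Lemma dilate1 : dilate 1 = 1.
Proof.
apply: fpsP => -[|[|n]] /=; rewrite ?mulr1 //.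
by case: odd; rewrite ?mul0r.
Qed.

Lemma sum_parity (F : nat -> R) m : \sum_(0 <= k < m.*2.+1) F k =
  \sum_(0 <= k < m.+1) F k.*2 + \sum_(0 <= k < m) F k.*2.+1.
Proof.
elim: m => [|m IH]; first by rewrite !big_nat1 big_nil addr0.
rewrite doubleS 2?big_nat_recr // IH [X in _ = X + _]big_nat_recr // [X in _ =
  _ + X]big_nat_recr //=.
by ring.
Qed.

Lemma dilateM f g : dilate (f * g) = dilate f * dilate g.
Proof.
apply: fpsP => n; rewrite [in RHS]fcoefM [LHS]/=.
case: (boolP (odd n)) => nodd.
  rewrite big1 // => i _ /=; case: (boolP (odd i)) => io; first by rewrite mul0r.
  by rewrite oddB ?nodd ?(negPf io) ?mulr0 // -ltnS.
rewrite -(odd_double_half n) (negPf nodd) add0n doubleK.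
move: n./2 => m {n nodd}.
rewrite -(big_mkord xpredT (fun i =>
  fcoef (dilate f) i * fcoef (dilate g) (m.*2 - i))).
rewrite sum_parity [X in _ + X]big1 ?addr0; last first.
  by move=> k _; rewrite /= odd_double mul0r.
rewrite -(big_mkord xpredT (fun i => fcoef f i * fcoef g (m - i))) mulr_suml.
apply: eq_big_nat => k km; rewrite /= -doubleB !odd_double !doubleK.
have -> : 3 ^+ m = 3 ^+ k * 3 ^+ (m - k) :> R by rewrite -exprD subnKC //; lia.
by ring.
Qed.
End Dilation.

Section DilatedSolution.
Variable R : comNzRingType.
Let x := fpsX R.
Variables t E T : fps R.
Hypothesis dilate_t : dilate t = x ^+ 2.
Hypothesis E_eq : E = 1 + t * E * (t * E + E - 1).
Hypothesis T_eq : T = 1 + t * E ^+ 2 * T.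
Let Ex := dilate E.
(** The even and odd parts of [E / (1 - x E) = (E + x E^2) / (1 - x^2 E^2)]. *)
Let P := dilate (E * T) + x * dilate (E ^+ 2 * T).

Lemma dilated_kernel_root : Ex = 1 + x ^+ 2 * Ex * (x ^+ 2 * Ex + Ex - 1).
Proof.
by rewrite /Ex {1}E_eq !(dilateD, dilateM, dilateN, dilate1) dilate_t.
Qed.

Let P_eq : P = Ex + x * Ex * P.
Proof.
have -> : Ex + x * Ex * P = Ex + x * dilate (E * (E * T))
    + x ^+ 2 * dilate (E * (E ^+ 2 * T)) by rewrite /P !dilateM /Ex; ring.
rewrite -dilate_t -dilateM.
have -> : t * (E * (E ^+ 2 * T)) = E * T - E by rewrite [in RHS]T_eq; ring.
by rewrite /P expr2 mulrA dilateD dilateN /Ex; ring.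
Qed.

Lemma num_DD_classes_dilate n : (num_DD_classes n)%:R =
  fcoef (dilate (E * T - t * E ^+ 2 + t * E) + x * dilate (E ^+ 2 * T - E ^+ 2)) n.
Proof.
rewrite (num_DD_classes_gf dilated_kernel_root P_eq); congr (fcoef _ n).
by rewrite -/x /P [E ^+ 2]expr2 !(dilateD, dilateN, dilateM) dilate_t /Ex; ring.
Qed.
End DilatedSolution.

Lemma cvg_along_subseq (R : realType) (P : pred nat) (phi : nat -> nat) (a b :
  nat -> R) :
  (forall n, P n -> n = phi n./2) ->
  (fun m => a (phi m) / b (phi m)) @ \oo --> (1 : R) -> equiv_along P a b.
Proof.
move=> Pphi /cvgn_distP H; apply/cvgrPdist_le => e /H[N HN].
rewrite near_withinE; exists (2 * N)%N => // n /= Nn Pn; rewrite (Pphi _ Pn).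
by apply: HN; lia.
Qed.

Lemma powR32 (R : realType) (x : R) : 0 < x -> x `^ (3 / 2) = x * Num.sqrt x.
Proof.
move=> x0; have -> : 3 / 2 = 1 + 2^-1 :> R by lra.
by rewrite powRD ?gt_eqF ?implybT // powRr1 ?powR12_sqrt // ltW.
Qed.

(** * Constants for the even and the odd part *)

Section CoefficientAsymptotics.
Variable R : realType.
Local Notation W := (@wt R).

Lemma geometric_asymp (f : fps R) : (forall n,
  `|fcoef f n| <= 3^-1 ^+ n) -> asymp f 0.
Proof.
move=> f3.
have W2 n : W n <= 4 * 2 ^+ n.
  have h : Num.sqrt n.+1%:R <= n.+1%:R :> R.
    rewrite -[leRHS]ger0_norm // -sqrtr_sqr ler_wsqrtr // expr2 ler_peMl ?ler1n //.
  apply: le_trans (_ : n.+1%:R * n.+1%:R <= _); first by rewrite ler_wpM2l.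
  have : (n.+1 * n.+1 <= 4 * 2 ^ n)%N.
    elim: n {h} => // n; rewrite expnS; case: n => [//|[//|n]]; nia.
  by rewrite -natrX -!natrM ler_nat.
apply/cvgn_distP => e e0.
have /cvgn_distP/(_ _ e0)[N HN] : (fun n => 4 * (2 / 3) ^+ n) @ \oo --> (0 : R).
  rewrite -(mulr0 4); apply: cvgM; first exact: cvg_cst.
  by apply: cvg_expr; rewrite ger0_norm; lra.
exists N => n /HN; rewrite !sub0r !normrN => h.
have p0 : 0 <= 4 * (2 / 3) ^+ n :> R by rewrite mulr_ge0 // exprn_ge0 //; lra.
apply: le_trans h; rewrite (ger0_norm p0) normrM (ger0_norm (ltW (wt_gt0 R n)))
  mulrC.
have -> : 4 * (2 / 3) ^+ n = 4 * 2 ^+ n * 3^-1 ^+ n :> R by rewrite exprMn; ring.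
by apply: ler_pM => //; rewrite ltW // wt_gt0.
Qed.

Lemma norm_sqrt_coef n : `|sqrt_coef R n| <= 1.
Proof.
elim: n => [|n IH]; first by rewrite normr1.
rewrite /= -mulrA normrM -[leRHS]mulr1 ler_pM //.
have n0 : 0 <= n%:R :> R by [].
by rewrite -[n.+1]addn1 natrD ler_norml ler_pdivlMr ?ler_pdivrMr; lra.
Qed.

Definition monom0 (a : R) : fps R := Fps (fun n => a *+ (n == 0%N)).
Definition monom1 (a : R) : fps R := Fps (fun n => a *+ (n == 1%N)).

Lemma monom0_asymp a : `|a| <= 1 -> asymp (monom0 a) 0.
Proof.
move=> a1; apply: geometric_asymp => -[|n] /=; first by rewrite expr0.
by rewrite normr0 exprn_ge0 // invr_ge0.
Qed.

Lemma monom0_val a : fps_val (monom0 a) = a.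
Proof.
apply: fps_val_uniq; rewrite -cvg_shiftS /=.
have -> : (fun n : nat => series (fcoef (monom0 a)) n.+1) = cst a;
  last exact: cvg_cst.
by apply/funext => n; rewrite /series /= big_nat_recl // big1 ?addr0.
Qed.

Lemma monom1_asymp a : `|a| <= 3^-1 -> asymp (monom1 a) 0.
Proof.
have p3 n : 0 <= 3^-1 ^+ n :> R by rewrite exprn_ge0 // invr_ge0.
by move=> a1; apply: geometric_asymp => -[|[|n]] /=; rewrite ?normr0 ?expr1.
Qed.

Lemma monom1_val a : fps_val (monom1 a) = a.
Proof.
apply: fps_val_uniq; rewrite -(cvg_shiftn 2) /=.
have -> : (fun n : nat => series (fcoef (monom1 a)) (n + 2)%N) = cst a;
  last exact: cvg_cst.
apply/funext => n; rewrite /series /= addn2 big_nat_recl // big_nat_recl // big1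
  //=.
by rewrite addr0 add0r.
Qed.

Lemma monom1M (a : R) (f : fps R) n : fcoef (monom1 a * f) n.+1 = a * fcoef f n.
Proof.
rewrite fcoefM !big_ord_recl /= mul0r add0r subSS subn0 big1 ?addr0 //.
by move=> i _ /=; rewrite mul0r.
Qed.

Lemma monom1M0 (a : R) (f : fps R) : fcoef (monom1 a * f) 0 = 0.
Proof. by rewrite fcoefM0 mul0r. Qed.

(** In the variable [u = 3 x^2], [t = u / 3] stands for [x^2], and the dominant singularity
    [x^2 = 1/3] becomes [u = 1]. *)
Let t := monom1 3^-1.

Let t_asymp : asymp t 0.
Proof. by apply: monom1_asymp; rewrite ger0_norm. Qed.

Let t_val : fps_val t = 3^-1. Proof. exact: monom1_val. Qed.

Lemma asymp_unshift (f : fps R) c : asymp (t * f) c -> asymp f (3 * c).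
Proof.
rewrite /asymp -cvg_shiftS /= => H.
have -> : (fun n => fcoef f n * W n) =
    (fun n => 3 * (fcoef (t * f) n.+1 * W n.+1) * (W (n + 1) / W n)^-1).
  apply/funext => n; rewrite monom1M addn1.
  have := wt_gt0 R n; have := wt_gt0 R n.+1.
  move: (W n) (W n.+1) => w w' w'0 w0; field; by rewrite !gt_eqF.
rewrite -[X in _ --> X]mulr1; apply: cvgM; last first.
  by rewrite -[X in _ --> X]invr1; apply: cvgV; [exact: oner_neq0|exact: wt_shift].
by apply: cvgM; first exact: cvg_cst.
Qed.

Let h := sqrt_lin (- 3^-1 : R).

Let h_bound n : `|fcoef h n| <= 3^-1 ^+ n.
Proof.
rewrite /fcoef normrM normrX normrN (ger0_norm (_ : 0 <= 3^-1)) ?invr_ge0 //.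
by rewrite ler_piMl ?exprn_ge0 ?invr_ge0 // norm_sqrt_coef.
Qed.

Let h_asymp : asymp h 0.
Proof. exact: geometric_asymp. Qed.

Let h_sqr : h ^+ 2 = 1 + t.
Proof.
rewrite sqrt_lin_sqr; congr (_ + _); apply: fpsP => n /=.
by rewrite mulNrn opprK.
Qed.

Let one_asymp : asymp (1 : fps R) 0.
Proof.
have -> : (1 : fps R) = monom0 1 by apply: fpsP => n.
by apply: monom0_asymp; rewrite normr1.
Qed.

Let one_val : fps_val (1 : fps R) = 1.
Proof.
have -> : (1 : fps R) = monom0 1 by apply: fpsP => n.
exact: monom0_val.
Qed.

Let summ := @asymp_summable R.

Let h_val : fps_val h = 2 / Num.sqrt 3.
Proof.
have hs := summ h_asymp.
have h2 : fps_val h ^+ 2 = (2 / Num.sqrt 3) ^+ 2.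
  rewrite expr2 -fps_valM // -expr2 h_sqr fps_valD;
    [|exact: summ one_asymp|exact: summ t_asymp].
  by rewrite one_val t_val expr_div_n sqr_sqrtr //; lra.
(* The square leaves the sign open; the partial sums are at least [1 - sum_(k >= 1) 3^-k = 1/2]. *)
have h0 : 0 <= fps_val h.
  apply: (cvgr_to_ge (abs_summable_val hs)); exists 1%N => // -[//|n] _.
  suff : 2^-1 + 2^-1 * 3^-1 ^+ n <= series (fcoef h) n.+1.
    have : 0 <= 3^-1 ^+ n :> R by rewrite exprn_ge0 // invr_ge0.
    by lra.
  elim: n => [|n IH]; first by rewrite /series /= big_nat1 /= !expr0; lra.
  rewrite seriesSr; apply: le_trans (lerD IH (lexx _)).
  have : - (3^-1 ^+ n.+1) <= fcoef h n.+1.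
    by rewrite lerNl; apply: le_trans (ler_norm _) _; rewrite normrN.
  by move: (fcoef h n.+1) => z; rewrite exprS; lra.
have s0 : 0 <= 2 / Num.sqrt 3 :> R by rewrite divr_ge0 // sqrtr_ge0.
by apply/eqP; rewrite -(eqrXn2 (ltn0Sn 1) h0 s0) h2.
Qed.

Let c1 : R := - (2 * Num.sqrt pi)^-1.
(** The square root of [(1 - 3 t) (1 + t)]: only the first factor is singular at [u = 1], and [h]
    has geometrically small coefficients. *)
Let s := sqrt_lin (1 : R) * h.

Let s_asymp : asymp s (fps_val h * c1).
Proof.
have := asympM (@sqrt_lin1_asymp R) h_asymp.
by rewrite mulr0 add0r.
Qed.

Let s_val : fps_val s = 0.
Proof.
rewrite fps_valM; [|exact: summ (@sqrt_lin1_asymp R)|exact: summ h_asymp].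
by rewrite sqrt_lin1_val mul0r.
Qed.

Let s_sqr : s ^+ 2 = - 3 * t ^+ 2 - 2 * t + 1.
Proof.
rewrite exprMn h_sqr sqrt_lin_sqr.
have -> : Fps (fun n => 1 *+ (n == 1%N)) = 3 * t :> fps R.
  have -> : 3 * t = t + t + t by ring.
  by apply: fpsP => -[|[|n]] /=; rewrite ?addr0 //; lra.
by ring.
Qed.

Let K_unit : 1 + t + s \is a GRing.unit.
Proof.
rewrite fps_unitE !fcoefD fcoefM0 /= !expr0 addr0 !mulr1.
by rewrite gt_eqF //; lra.
Qed.

Let E := 2 / (1 + t + s).

Let E_eq : E = 1 + t * E * (t * E + E - 1).
Proof. exact: kernel_root. Qed.

Let inv1t : fps R := Fps (fun n => (- 3^-1) ^+ n).

Let inv1tE : (1 + t) * inv1t = 1.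
Proof.
rewrite mulrDl mul1r; apply: fpsP => -[|n]; rewrite fcoefD.
  by rewrite monom1M0 /= expr0 addr0.
by rewrite monom1M /= exprS; ring.
Qed.

Let inv1t_asymp : asymp inv1t 0.
Proof.
by apply: geometric_asymp => n; rewrite /= normrX normrN ger0_norm ?invr_ge0.
Qed.

Let inv1t_val : fps_val inv1t = 3 / 4.
Proof.
have := congr1 (@fps_val R) inv1tE; rewrite one_val fps_valM; last first.
- exact: summ inv1t_asymp.
- exact: summ (asympD one_asymp t_asymp).
rewrite fps_valD ?one_val ?t_val; [lra|exact: summ one_asymp|exact: summ t_asymp].
Qed.

(** [t * Y] is the conjugate [1 + t - s], linear in [s]; so [E] is reached by a shift and a product
    with [1 / (1 + t)], without inverting [1 + t + s]. *)
Let Y := 2 * (1 + t) * E.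

Let tY : t * Y = 1 + t - s.
Proof.
apply: (mulIr K_unit).
have -> : t * Y * (1 + t + s) = 2 * t * (1 + t) * (E * (1 + t +
  s)) by rewrite /Y; ring.
by rewrite divrK //; ring: s_sqr.
Qed.

Let Y_asymp : asymp Y (- (3 * (fps_val h * c1))).
Proof.
have := asympD (asympD one_asymp t_asymp) (asympN s_asymp).
by rewrite -tY !add0r => /asymp_unshift; rewrite mulrN.
Qed.

Let Y_val : fps_val Y = 4.
Proof.
have := congr1 (@fps_val R) tY.
rewrite fps_valM; [|exact: summ t_asymp|exact: summ Y_asymp].
rewrite fps_valD; last first.
- exact: summ (asympN s_asymp).
- exact: summ (asympD one_asymp t_asymp).
rewrite fps_valN; last exact: summ s_asymp.
rewrite fps_valD ?one_val ?t_val ?s_val;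
  [lra|exact: summ one_asymp|exact: summ t_asymp].
Qed.

Let half := monom0 2^-1.

Let half_asymp : asymp half 0.
Proof. by apply: monom0_asymp; rewrite ger0_norm //; lra. Qed.

Let E_half : E = half * (Y * inv1t).
Proof.
have half2 : half * 2 = 1.
  have -> : half * 2 = half + half by ring.
  by apply: fpsP => -[|n] /=; rewrite ?addr0 //; lra.
have -> : half * (Y * inv1t) = half * 2 * ((1 + t) * inv1t) * E by rewrite /Y; ring.
by rewrite half2 inv1tE !mul1r.
Qed.

Let cE : R := 9 / 8 / (Num.sqrt 3 * Num.sqrt pi).

Let E_asymp : asymp E cE.
Proof.
have := asympM half_asymp (asympM Y_asymp inv1t_asymp).
rewrite -E_half monom0_val inv1t_val h_val /c1; congr (asymp _ _).
rewrite /cE; have := sqrtr_gt0 (3 : R); have := sqrtr_gt0 (pi : R); rewrite pi_gt0.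
move: (Num.sqrt 3) (Num.sqrt pi) => p q p0 q0.
by rewrite !mulr0 addr0 add0r; field; rewrite !gt_eqF // q0.
Qed.

Let E_val : fps_val E = 3 / 2.
Proof.
have YIs := asympM Y_asymp inv1t_asymp.
rewrite E_half fps_valM; [|exact: summ half_asymp|exact: summ YIs].
rewrite fps_valM; [|exact: summ Y_asymp|exact: summ inv1t_asymp].
by rewrite monom0_val Y_val inv1t_val; lra.
Qed.
Let g := t * E ^+ 2.

Let E0 : fcoef E 0 = 1.
Proof. by rewrite E_eq !(fcoefD, fcoefM0, fcoefN) /= !mul0r addr0. Qed.

Let g0 : fcoef g 0 = 0. Proof. exact: monom1M0. Qed.

Let g_unit : 1 - g \is a GRing.unit.
Proof. by rewrite fps_unitE fcoefD fcoefN g0 subr0 /= oner_neq0. Qed.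

Let T := (1 - g)^-1.

Let T_eq : T = 1 + g * T.
Proof.
have : (1 - g) * T = 1 by rewrite divrr.
by rewrite mulrBl mul1r => <-; rewrite subrK.
Qed.

Let x := fpsX R.

Let dilate_t : dilate t = x ^+ 2.
Proof.
have -> : x ^+ 2 = x * (x * 1) by rewrite mulr1.
apply: fpsP => -[|[|[|[|n]]]]; rewrite ?fcoefXM ?fcoefXM0 /= ?mul0r //.
  by rewrite ?expr1 mulVf.
by rewrite if_same.
Qed.

Let ev := E * T - g + t * E.
Let od := E ^+ 2 * T - E ^+ 2.

Let num_gf n : (num_DD_classes n)%:R = fcoef (dilate ev + x * dilate od) n.
Proof. exact: num_DD_classes_dilate dilate_t E_eq T_eq n. Qed.

Let num_even m : (num_DD_classes m.*2)%:R = fcoef ev m * 3 ^+ m.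
Proof.
rewrite num_gf fcoefD; case: m => [|m]; rewrite ?fcoefXM0 ?addr0 // doubleS fcoefXM.
by rewrite /= odd_double /= doubleK addr0.
Qed.

Let num_odd m : (num_DD_classes m.*2.+1)%:R = fcoef od m * 3 ^+ m.
Proof. by rewrite num_gf fcoefD fcoefXM /= odd_double /= doubleK add0r. Qed.

(** Up to the factor [3 ^+ n] the coefficient counts words that end at height 0. *)
Let E_ge0 n : 0 <= fcoef E n.
Proof.
have [e _ _] := run_count_gf (dilated_kernel_root dilate_t E_eq) n.*2 0.
have : 0 <= fcoef E n * 3 ^+ n.
  by have := ler0n R (run_count n.*2 (state_is 0 0));
    rewrite e /= odd_double doubleK.
by rewrite pmulr_lge0 // exprn_gt0.
Qed.

Let g_ge0 n : 0 <= fcoef g n.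
Proof.
case: n => [|n]; first by rewrite g0.
rewrite monom1M mulr_ge0 ?invr_ge0 // expr2 fcoefM.
by apply: sumr_ge0 => i _; rewrite mulr_ge0.
Qed.

Let EE_asymp : asymp (E ^+ 2) (3 * cE).
Proof.
by have := asympM E_asymp E_asymp; rewrite -expr2 E_val; congr asymp; lra.
Qed.

Let EE_val : fps_val (E ^+ 2) = 9 / 4.
Proof.
by rewrite expr2 fps_valM; [rewrite E_val;
  lra|exact: summ E_asymp|exact: summ E_asymp].
Qed.

Let g_asymp : asymp g cE.
Proof.
by have := asympM t_asymp EE_asymp; rewrite t_val mulr0 addr0; congr asymp; lra.
Qed.

Let g_val : fps_val g = 3 / 4.
Proof.
by rewrite fps_valM; [rewrite t_val EE_val;
  lra|exact: summ t_asymp|exact: summ EE_asymp].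
Qed.

Let g_val_le : fps_val g <= 3 / 4. Proof. by rewrite g_val. Qed.

Let T_val : fps_val T = 4.
Proof. by have := renewal_val g_ge0 g0 g_asymp g_val_le T_eq; rewrite g_val;
  lra. Qed.

Let T_asymp : asymp T (16 * cE).
Proof.
have := renewal_asymp g_ge0 g0 g_asymp g_val_le T_eq.
by rewrite T_val; congr asymp; lra.
Qed.

Let ev_asymp : asymp ev (82 / 3 * cE).
Proof.
have H1 := asympM E_asymp T_asymp; have H2 := asympM t_asymp E_asymp.
have := asympD (asympD H1 (asympN g_asymp)) H2.
(* In units of [cE]: 3/2 * 16 + 4 from [E * T], -1 from [g], 1/3 from [t * E]. *)
by rewrite E_val T_val t_val; congr asymp; lra.
Qed.

Let od_asymp : asymp od (45 * cE).
Proof.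
have H1 := asympM EE_asymp T_asymp.
have := asympD H1 (asympN EE_asymp).
by rewrite EE_val T_val; congr asymp; lra.
Qed.

Let wt_double j : (fun m => (m.*2 + j)%:R * Num.sqrt (m.*2 + j)%:R / W m) @ \oo -->
  (2 * Num.sqrt 2 : R).
Proof.
pose r m : R := (m.*2 + j)%:R / m.+1%:R.
have r2 : r @ \oo --> (2 : R).
  have -> : r = (fun m => (2 : R) + (j%:R - 2) * harmonic m).
    apply/funext => m; rewrite /r /harmonic /= -mul2n natrD natrM -[m.+1]addn1
      natrD.
    by field; rewrite natr1 pnatr_eq0.
  rewrite -[X in _ --> X]addr0; apply: cvgD; first exact: cvg_cst.
  rewrite -(mulr0 (j%:R - 2)); apply: cvgM; first exact: cvg_cst.
  exact: cvg_harmonic.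
have -> : (fun m => (m.*2 + j)%:R * Num.sqrt (m.*2 + j)%:R / W m) =
    (fun m => r m * Num.sqrt (r m)).
  apply/funext => m; rewrite /r sqrtrM ?ler0n // sqrtrV ?ler0n // /wt.
  have : 0 < m.+1%:R :> R by [].
  move: (m.+1%:R) (m.*2 + j)%:R => p q p0; field.
  by rewrite !gt_eqF ?sqrtr_gt0.
apply: cvgM => //; apply: continuous_cvg => //; exact: sqrt_continuous.
Qed.

Let cE_sqrt : cE * Num.sqrt 3 * Num.sqrt pi = 9 / 8.
Proof.
rewrite /cE; have := sqrtr_gt0 (3 : R); have := sqrtr_gt0 (pi : R); rewrite pi_gt0.
move: (Num.sqrt 3) (Num.sqrt pi) => p q q0 p0.
by field; rewrite !gt_eqF // p0.
Qed.

Let sqrt3X m : Num.sqrt 3 ^+ m.*2 = 3 ^+ m :> R.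
Proof. by rewrite -mul2n exprM sqr_sqrtr. Qed.

Let pi_sqrt_gt0 : 0 < Num.sqrt pi :> R.
Proof. by rewrite sqrtr_gt0 pi_gt0. Qed.

(** Both parities share the exponent [m.*2.+1], which is [n + 1] for [n = 2 m] and [n] for
    [n = 2 m + 1]. The value of [k] combines [cE], the factor [2 sqrt 2] from [m] to [n], and the
    extra [sqrt 3]. *)
Let ratio_cvg (f : fps R) (j : nat) (c k : R) : 0 < c -> asymp f (c * cE) ->
  k = 3 / 4 * c * Num.sqrt 2 / Num.sqrt pi ->
  (fun m => fcoef f m * 3 ^+ m /
    (k * (Num.sqrt 3 ^+ (m.*2.+1) / (m.*2 + j)%:R `^ (3 / 2)))) @ \oo --> (1 : R).
Proof.
move=> c0 fc kE.
pose C : R := 4 / 3 / c * Num.sqrt pi / (Num.sqrt 2 * Num.sqrt 3).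
have sqrt2_gt0 : 0 < Num.sqrt 2 :> R by rewrite sqrtr_gt0.
have sqrt3_gt0 : 0 < Num.sqrt 3 :> R by rewrite sqrtr_gt0.
have lim1 : c * cE * (2 * Num.sqrt 2) * C = 1.
  have sqrt3_sqr : Num.sqrt 3 ^+ 2 = 3 :> R by rewrite sqr_sqrtr.
  have -> : c * cE * (2 * Num.sqrt 2) * C =
      8 / 9 * (cE * Num.sqrt 3 * Num.sqrt pi) * (3 / Num.sqrt 3 ^+ 2).
    rewrite /C; move: cE (Num.sqrt 2) (Num.sqrt 3) (Num.sqrt pi) sqrt2_gt0
      sqrt3_gt0.
    by move=> e u v w u0 v0; field; rewrite !gt_eqF.
  by rewrite cE_sqrt sqrt3_sqr; lra.
have := cvgM (cvgM fc (wt_double j)) (cvg_cst C); rewrite lim1 => H.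
apply: (@cvg_trans _ ((fun m => fcoef f m * W m *
  ((m.*2 + j)%:R * Num.sqrt (m.*2 + j)%:R / W m) * C) @ \oo)); last exact: H.
(* [m = 0] is excluded because the base of the power would vanish for [j = 0]. *)
apply: near_eq_cvg; exists 1%N => // m /= m0.
rewrite kE exprS sqrt3X powR32 ?ltr0n ?addn_gt0 ?double_gt0 ?m0 //.
have := wt_gt0 R m; rewrite /C.
have N0 : 0 < (m.*2 + j)%:R :> R by rewrite ltr0n addn_gt0 double_gt0 m0.
have : 0 < Num.sqrt (m.*2 + j)%:R :> R by rewrite sqrtr_gt0.
have : 0 < 3 ^+ m :> R by rewrite exprn_gt0.
move: (W m) (3 ^+ m) (m.*2 + j)%:R (Num.sqrt (m.*2 + j)%:R) N0.
move: (Num.sqrt 2) (Num.sqrt 3) (Num.sqrt pi) sqrt2_gt0 sqrt3_gt0 pi_sqrt_gt0.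
move=> u v p u0 v0 p0 w A N q N0 A0 q0 w0.
by field; rewrite !gt_eqF.
Qed.

Lemma num_DD_classes_even_asymp : equiv_along (fun n => ~~ odd n)
  (fun n => (num_DD_classes n)%:R : R)
  (fun n => 41 * Num.sqrt 2 / (2 * Num.sqrt pi)
            * (Num.sqrt 3 ^+ n.+1 / n%:R `^ (3 / 2))).
Proof.
apply: (@cvg_along_subseq _ _ (fun m => m.*2)).
  by move=> n /negPf nodd; rewrite -[LHS]odd_double_half nodd.
under eq_fun do rewrite num_even -[X in X%:R `^ _]addn0.
apply: ratio_cvg ev_asymp _; first by lra.
by move: (Num.sqrt 2) (Num.sqrt pi) pi_sqrt_gt0 => u p p0; field; rewrite gt_eqF.
Qed.

Lemma num_DD_classes_odd_asymp : equiv_along odd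
  (fun n => (num_DD_classes n)%:R : R)
  (fun n => 135 * Num.sqrt 2 / (4 * Num.sqrt pi)
            * (Num.sqrt 3 ^+ n / n%:R `^ (3 / 2))).
Proof.
apply: (@cvg_along_subseq _ _ (fun m => m.*2.+1)).
  by move=> n nodd; rewrite -[LHS]odd_double_half nodd.
under eq_fun do rewrite num_odd -[X in X%:R `^ _]addn1.
apply: ratio_cvg od_asymp _; first by lra.
by move: (Num.sqrt 2) (Num.sqrt pi) pi_sqrt_gt0 => u p p0; field; rewrite gt_eqF.
Qed.
End CoefficientAsymptotics.

Local Close Scope classical_set_scope.
Unset Implicit Arguments.

Theorem theorem3p15 (R : realType) :
  let x : fps rat := fpsX rat in
  let s : fps rat := fps_sqrt (- 3 * x ^+ 4 - 2 * x ^+ 2 + 1) in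
  let L : fps rat := DD_gf in
  let a (n : nat) : R := (num_DD_classes n)%:R in
  [/\ L = ((4 * x ^+ 4 - 4 * x ^+ 2 - 4) * s
             + 8 * x ^+ 8 + 20 * x ^+ 6 + 8 * x ^+ 4 - 8 * x ^+ 3 - 4)
          / (((- x ^+ 2 - 1) * s + x ^+ 4 + 2 * x ^+ 2 - 1)
             * (x ^+ 2 + s + 1) ^+ 2),
      (x ^+ 10 - x ^+ 9 + 4 * x ^+ 8 - 3 * x ^+ 7 + 5 * x ^+ 6 - 5 * x ^+ 5
         + 2 * x ^+ 4 - 2 * x ^+ 3 + x ^+ 2 - x + 1)
      + (- x ^+ 10 + x ^+ 9 - 6 * x ^+ 8 + 5 * x ^+ 7 - 9 * x ^+ 6 + 6 * x ^+ 5
         - 3 * x ^+ 4 + 3 * x ^+ 3 + x - 1) * L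
      + (x ^+ 10 - x ^+ 9 + 4 * x ^+ 8 - 3 * x ^+ 7 + 5 * x ^+ 6 - 3 * x ^+ 5
         + 2 * x ^+ 4 - x ^+ 3) * L ^+ 2 = 0,
      [seq num_DD_classes n | n <- iota 2 14]
        = [:: 1; 1; 2; 1; 4; 5; 11; 11; 27; 33; 73; 88; 194; 247]%N,
      equiv_along (fun n => ~~ odd n) a
        (fun n => 41 * Num.sqrt 2 / (2 * Num.sqrt pi)
                  * (Num.sqrt 3 ^+ n.+1 / n%:R `^ (3 / 2)))
    & equiv_along odd a
        (fun n => 135 * Num.sqrt 2 / (4 * Num.sqrt pi)
                  * (Num.sqrt 3 ^+ n / n%:R `^ (3 / 2)))].
Proof.
move=> x s L a; split.
- exact: DD_gf_closed_form.
- exact: DD_gf_quadratic.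
- exact: num_DD_classes_2_15.
- exact: num_DD_classes_even_asymp.
- exact: num_DD_classes_odd_asymp.
Qed.
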